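(* For every real $\epsilon>0$ there exists a number $n_\epsilon$ such that the following holds: if $G$ is a graph of order at least $n_\epsilon$ and average degree at least $14+\epsilon$, then $G$ contains two vertex-disjoint cycles whose lengths are $2r$ and $2r+2$ for some integer $r\geq 2$.
   Context: All graphs are finite and simple. *)

(* Defs.v *)
From mathcomp Require Import all_boot all_order all_algebra.
From mathcomp Require Import reals.

Set Implicit Arguments.
Unset Strict Implicit.
Unset Printing Implicit Defensive.

Import GRing.Theory Num.Theory.
Local Open Scope ring_scope.

(* Finite simple graphs. *)
Record sgraph := SGraph {
  vertex :> finType;
  adj : rel vertex;
  adj_sym : symmetric adj;
  adj_irrefl : irreflexive adj }.

Definition degree (G : sgraph) (x : G) : nat := #|[set y : G | adj x y]|.

(* The graph with no vertices gets average degree 0, since 0 / 0 = 0. *)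
Definition avg_degree (R : realType) (G : sgraph) : R :=
  (\sum_(x : G) degree x)%N%:R / #|G|%:R.

(* A cycle is given by the list of its vertices in cyclic order, so its length
   is the size of the list. The size bound is needed because [ucycle] accepts
   the empty list and, for an edge xy, the list [:: x; y]. *)
Definition graph_cycle (G : sgraph) (c : seq G) : Prop :=
  (3 <= size c)%N /\ ucycle (@adj G) c.

(* Main.v *)
Require Import Defs.
From mathcomp Require Import all_boot all_order all_algebra.
From mathcomp Require Import reals zify.

(* Let m be the sum of the degrees and s a suitable power of log n. The set A of the
   vertices of degree above m / N, with N of order s^2, has at most N elements. Either a C_4 and
   a disjoint C_6 are found through A, or some set U disjoint from A has average degree above 8
   even after any O(s^2) of its vertices are deleted. It then suffices that every graph of
   average degree above 8 contains cycles of lengths 2r and 2r + 2 with r <= s: deleting such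
   cycles repeatedly, some r occurs twice.

   For this, pass to a bipartite subgraph of average degree above 4, and then to a minimal
   subgraph above a density threshold that increases slowly with the order. The latter has
   minimum degree 3 and expands: after deleting a small set K spanning at least |K| edges, a
   ball D of radius O(s) contains all but O(s) vertices. Let D absorb neighbours as long as the
   rest contains a set with at least as many edges as vertices. At the end the rest is
   2-regular and each of its vertices is adjacent to D. Two vertices at distance k - 1 on a
   cycle of length 2k of the rest are joined by a short path through D, and the two arcs of
   lengths k - 1 and k + 1 complete it to cycles whose lengths differ by 2. *)

Set Implicit Arguments.
Unset Strict Implicit.
Unset Printing Implicit Defensive.

(** * Degrees, edge counts, connectivity *)

Section Graph.
Variables (T : finType) (e : rel T).
Hypotheses (e_sym : symmetric e) (e_irr : irreflexive e).
Implicit Types (U V W X D K P : {set T}) (x y z v : T) (c p : seq T).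

Definition deg V x : nat := \sum_(y in V) e x y.

(* Ordered pairs are counted, so this is twice the number of edges inside [U]. *)
Definition e2 U : nat := \sum_(x in U) deg U x.

Lemma degE V x : deg V x = #|[set y in V | e x y]|.
Proof.
rewrite /deg -sum1_card [RHS](eq_bigl (fun y => (y \in V) && e x y)); last by move=> y; rewrite inE.
by rewrite -big_mkcondr.
Qed.

Lemma e2E U : e2 U = \sum_x \sum_y [&& x \in U, y \in U & e x y].
Proof.
rewrite /e2 big_mkcond; apply: eq_bigr => x _; case: (x \in U) => /=; last by rewrite big1.
by rewrite /deg big_mkcond; apply: eq_bigr => y _; case: (y \in U).
Qed.

Lemma deg_exchange U V : \sum_(x in U) deg V x = \sum_(y in V) deg U y.
Proof. by rewrite /deg exchange_big; apply: eq_bigr => x _; apply: eq_bigr => y _; rewrite e_sym. Qed.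

Lemma deg_setID U X x : deg U x = deg (U :&: X) x + deg (U :\: X) x.
Proof. exact: big_setID. Qed.

Lemma leq_deg U V x : U \subset V -> deg U x <= deg V x.
Proof. by move=> UV; rewrite (deg_setID V U) (setIidPr UV) leq_addr. Qed.

Lemma deg_le_card V x : deg V x <= #|V|.
Proof. by rewrite degE subset_leq_card //; apply/subsetP => y; rewrite inE => /andP[]. Qed.

Lemma deg_gt0P V x : reflect (exists2 y, y \in V & e x y) (0 < deg V x).
Proof.
rewrite degE; apply: (iffP card_gt0P) => [[y]|[y yV exy]]; first by rewrite inE => /andP[]; exists y.
by exists y; rewrite inE yV.
Qed.

Lemma deg_setD1 V x v : v \in V -> deg V x = e x v + deg (V :\ v) x.
Proof. by move=> vV; rewrite /deg (big_setD1 v). Qed.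

Lemma deg_setD1_self V x : deg (V :\ x) x = deg V x.
Proof.
case: (boolP (x \in V)) => xV; first by rewrite (deg_setD1 x xV) e_irr.
by rewrite (setDidPl _) // disjoint_sym disjoints1.
Qed.

Lemma e2_setID U X : X \subset U ->
  e2 U = e2 X + 2 * \sum_(x in X) deg (U :\: X) x + e2 (U :\: X).
Proof.
move=> XU; rewrite /e2 (big_setID X) /= (setIidPr XU).
under eq_bigr do rewrite (deg_setID U X) (setIidPr XU).
under [X in _ + X = _]eq_bigr do rewrite (deg_setID U X) (setIidPr XU).
rewrite !big_split /= (deg_exchange (U :\: X) X); lia.
Qed.

Lemma e2_setD1 U v : v \in U -> e2 U = e2 (U :\ v) + 2 * deg U v.
Proof.
move=> vU; rewrite (@e2_setID U [set v]) ?sub1set // {1}/e2 !big_set1.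
have -> : deg [set v] v = 0 by rewrite /deg big_set1 e_irr.
by rewrite deg_setD1_self addnC.
Qed.

Lemma e2_cover U V W : U \subset V :|: W ->
  (forall x y, x \in V :\: W -> y \in W :\: V -> ~~ e x y) ->
  e2 U <= e2 V + e2 W.
Proof.
move=> UVW nVW; rewrite !e2E -big_split /=; apply: leq_sum => x _.
rewrite -big_split /=; apply: leq_sum => y _.
case exy: (e x y); rewrite ?andbF //= !andbT.
case: (boolP (x \in U)) => //= /(subsetP UVW); rewrite inE => xVW.
case: (boolP (y \in U)) => //= /(subsetP UVW); rewrite inE => yVW.
have := nVW x y; have := nVW y x; rewrite !inE e_sym exy.
by move: xVW yVW; do 4!case: (_ \in _) => //=; move=> _ _ H1 H2; (have := H1 isT isT) || (have := H2 isT isT).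
Qed.

Lemma e2_set0 : e2 set0 = 0. Proof. by rewrite /e2 big_set0. Qed.

(* [X] induces a connected subgraph containing [x]. *)
Definition conn x X := x \in X /\
  forall D, x \in D -> D \proper X -> exists2 y, y \in D & exists2 z, z \in X :\: D & e y z.

Lemma conn1 x : conn x [set x].
Proof.
split; first by rewrite inE.
by move=> D xD; rewrite properEneq subset1 => /andP[/negPf->] /eqP D0; rewrite D0 inE in xD.
Qed.

Lemma connU x X Y : conn x X -> conn x Y -> conn x (X :|: Y).
Proof.
move=> [xX cX] [xY cY]; split; first by rewrite inE xX.
move=> D xD /properP[DXY [w wXY wD]].
wlog wX : X Y xX xY cX cY DXY wXY / w \in X.
  move=> H; move: (wXY); rewrite inE => /orP[/H|/H]; first exact.
  by rewrite setUC; apply => //; rewrite setUC.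
case: (cX (D :&: X)); first by rewrite inE xD.
  by apply/properP; split; [exact: subsetIr | exists w; rewrite ?inE // (negPf wD)].
move=> y; rewrite inE => /andP[yD _] [z]; rewrite !inE negb_and => /andP[/orP[zD|/negPf->]] // zX eyz.
by exists y => //; exists z; rewrite // !inE zX zD.
Qed.

Lemma conn_setU1 x X z v : conn x X -> z \in X -> e z v -> conn x (v |: X).
Proof.
move=> [xX cX] zX ezv; split; first by rewrite inE xX orbT.
move=> D xD pD; have [DX|nDX] := boolP (X \subset D).
  exists z; first exact: (subsetP DX).
  exists v => //; rewrite !inE eqxx orTb andbT; apply/negP => vD.
  by move: pD; rewrite properE subUset sub1set vD DX andbF.
case: (cX (D :&: X)); first by rewrite inE xD.
  by rewrite properE subsetIr subsetI subxx andbT.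
move=> y; rewrite inE => /andP[yD _] [w]; rewrite !inE negb_and => /andP[/orP[wD|/negPf->]] // wX eyw.
by exists y => //; exists w; rewrite // !inE wX wD orbT.
Qed.

(** A largest [D] containing [x] with at least [#|D| - 1] edges must be [X]: otherwise connectedness
    supplies one more vertex together with an edge. *)
Lemma conn_e2 x X : conn x X -> 2 * #|X| <= e2 X + 2.
Proof.
move=> [xX cX].
pose good D := [&& x \in D, D \subset X & 2 * #|D| <= e2 D + 2].
have g1 : good [set x] by rewrite /good inE eqxx sub1set xX cards1 leq_addl.
case: (@arg_maxnP _ _ good (fun D => #|D|) g1) => D /and3P[xD DX cD] Dmax.
have [->//|nDX] := eqVneq X D.
have pD : D \proper X by rewrite properEneq eq_sym nDX.
have [y yD [z zX eyz]] := cX D xD pD; move: zX; rewrite inE => /andP[zD zX].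
have : good (z |: D).
  rewrite /good inE xD orbT subUset sub1set zX DX cardsU1 zD /=.
  rewrite (@e2_setD1 (z |: D) z) ?setU11 // setU1K //.
  have : 0 < deg (z |: D) z by apply/deg_gt0P; exists y; rewrite ?inE ?yD ?orbT // e_sym.
  lia.
by move/Dmax; rewrite cardsU1 zD /=; lia.
Qed.

(** The first vertex of a longest path has a neighbour besides its successor; by maximality this
    neighbour lies on the path and closes a cycle. *)
Lemma min_degree2_cycle U : U != set0 -> (forall x, x \in U -> 1 < deg U x) ->
  exists c, [/\ 2 < size c, ucycle e c & {subset c <= U}].
Proof.
move=> /set0Pn[x0 x0U] dU.
pose good n := [exists t : n.-tuple T, [&& 0 < n, uniq t, sorted e t & all (mem U) t]].
have g1 : exists n, good n by exists 1; apply/existsP; exists [tuple x0]; rewrite /= x0U.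
have gmax n : good n -> n <= #|T|.
  by move=> /existsP[t /and4P[_ ut _ _]]; rewrite -(size_tuple t) -(card_uniqP ut) max_card.
case: (ex_maxnP g1 gmax) => n /existsP[t /and4P[n0 ut st aU]] nmax.
case def_t: (tval t) (size_tuple t) => [|x p] szt; first by move: n0; rewrite -szt.
move: ut st aU; rewrite def_t /= => /andP[xp up] pp /andP[xU pU].
(* For a one-vertex path [head x p] is [x] itself, whose removal does not change its own degree. *)
have : 0 < deg (U :\ head x p) x.
  move: (dU x xU); case: p pp {def_t szt xp up pU} => [_|y p /andP[exy _]] /=; first by rewrite deg_setD1_self; lia.
  case: (boolP (y \in U)) => [yU|yU]; first by rewrite (deg_setD1 _ yU) exy; lia.
  by rewrite (setDidPl _) 1?disjoint_sym ?disjoints1 //; lia.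
case/deg_gt0P => z; rewrite !inE => /andP[zh zU] exz.
have zx : z != x by apply/eqP => zx; rewrite zx e_irr in exz.
have zp : z \in p.
  apply/negPn/negP => zp; have : good n.+1.
    have sz : size [:: z, x & p] == n.+1 by rewrite /= -szt.
    apply/existsP; exists (Tuple sz) => /=.
    by rewrite e_sym exz pp xU zU pU !inE negb_or zx zp xp up.
  by move/nmax; rewrite ltnn.
case/splitPr: zp zh xp up pp pU {szt def_t} => p1 p2 zh xp up pp pU.
exists (x :: rcons p1 z); split.
- by case: p1 zh {xp up pp pU} => //=; rewrite ?eqxx // => *; rewrite size_rcons.
- rewrite /ucycle /= rcons_path last_rcons e_sym exz andbT.
  move: pp xp up; rewrite cat_path /= => /and3P[p1e elz _].
  rewrite rcons_path p1e elz mem_rcons mem_cat !inE !negb_or => /and3P[xp1 -> _].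
  by rewrite xp1 rcons_uniq cat_uniq /= negb_or => /and3P[-> /andP[-> _] _].
- move=> w; rewrite inE mem_rcons inE => /or3P[/eqP->//|/eqP->//|wp].
  by apply: (allP pU); rewrite mem_cat wp.
Qed.

End Graph.

(** * Cycles whose lengths differ by two *)

Section Absorption.
Variables (T : finType) (e : rel T).
Hypotheses (e_sym : symmetric e) (e_irr : irreflexive e).
Implicit Types (U V W X D K P : {set T}) (x y z v : T) (c p : seq T).

(** A connected set stands in for a path from [x] to [y]: two such sets share [x], so their union is
    connected whatever else they have in common. *)
Definition near x D r y := exists P, [/\ P \subset D, conn e x P, y \in P & #|P| <= r].

Lemma near_weaken x D D' r r' y : D \subset D' -> r <= r' -> near x D r y -> near x D' r' y.
Proof.
move=> DD' rr' [P [PD cP yP Pr]]; exists P; split=> //; first exact: subset_trans DD'.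
exact: leq_trans rr'.
Qed.

Lemma near_setU1 x D r y z : near x D r y -> e y z -> near x (z |: D) r.+1 z.
Proof.
move=> [P [PD cP yP Pr]] eyz; exists (z |: P); split; rewrite ?setU11 ?setUS //.
  exact: conn_setU1 eyz.
by rewrite cardsU1; case: (z \notin P) => /=; rewrite ?ltnS //; apply: leqW.
Qed.

Lemma e2_even U : ~~ odd (e2 e U).
Proof.
elim: {U}_.+1 {-2}U (ltnSn #|U|) => // n IHn U Un.
have [->|/set0Pn[v vU]] := eqVneq U set0; first by rewrite e2_set0.
rewrite (e2_setD1 e_sym e_irr vU) oddD oddM /= addbF; apply: IHn.
by move: Un; rewrite (cardsD1 v U) vU.
Qed.

(* [D] absorbs a neighbour [r] as long as a set with as many edges as vertices survives
   outside [r |: D]. When this stops, every vertex of [U :\: D] is adjacent to [D] and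
   [U :\: D] is 2-regular, by counting degrees. *)
Lemma absorb n r x U D K :
  conn e x U -> (forall y, y \in U -> 2 < deg e U y) -> D \subset U -> x \in D ->
  #|U :\: D| <= n -> (forall y, y \in D -> near x D r y) ->
  K \subset U :\: D -> K != set0 -> 2 * #|K| <= e2 e K ->
  exists D' c, [/\ 2 < size c <= n, ucycle e c, D' \subset U /\ {subset c <= U :\: D'},
    forall y, y \in D' -> near x D' (r + n) y &
    forall y, y \in c -> exists2 z, z \in D' & e z y].
Proof.
move=> cU dU; elim: n r D K => [|n IHn] r D K DU xD Un nD KU K0 eK.
  move: Un; rewrite leqn0 cards_eq0 => /eqP UD.
  by move: KU K0; rewrite UD subset0 => ->.
pose R := [set v in U :\: D | 0 < deg e D v].
case: (pickP (fun q : T * {set T} => [&& q.1 \in R, q.2 \subset (U :\: D) :\ q.1,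
    q.2 != set0 & 2 * #|q.2| <= e2 e q.2])) => [[v K'] /= /and4P[]|noabs].
  rewrite inE => /andP[vUD /deg_gt0P[z zD evz]] K'U K'0 eK'; move: (vUD); rewrite inE => /andP[vD vU].
  have UvD : (U :\: D) :\ v = U :\: (v |: D) by rewrite setDDl setUC.
  case: (IHn r.+1 (v |: D) K').
  - by rewrite subUset sub1set vU.
  - by rewrite inE xD orbT.
  - by rewrite -UvD; move: Un; rewrite (cardsD1 v (U :\: D)) vUD.
  - move=> y; rewrite inE => /orP[|yD]; last by apply: near_weaken (nD y yD); rewrite ?subsetUr.
    by rewrite inE => /eqP->; apply: (near_setU1 (nD z zD)); rewrite e_sym.
  - by rewrite -UvD.
  - by [].
  - by [].
  move=> D' [c [/andP[c2 cn] uc cU' nD' aD']]; exists D', c; split => //; first by rewrite c2 ltnW.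
  by move=> y /nD'; rewrite addnS.
set K1 := U :\: D in Un KU R noabs *.
have degK1 v : v \in K1 -> deg e U v = deg e D v + deg e K1 v.
  by move=> _; rewrite (deg_setID e U D) (setIidPr DU).
have nRdeg v : v \in K1 -> v \notin R -> 2 < deg e K1 v.
  move=> vK; rewrite inE vK lt0n negbK => /eqP d0.
  by have := degK1 v vK; rewrite d0 add0n => <-; apply: dU; move: vK; rewrite inE => /andP[].
(* A vertex of [R] outside [K] could be absorbed, with [K] surviving. *)
have RK : R \subset K.
  apply/subsetP => v vR; apply/negPn/negP => vK.
  by have := noabs (v, K); rewrite /= vR K0 eK subsetD1 KU vK.
have eK1 : 2 * #|K1| <= e2 e K1.
  rewrite (e2_setID e_sym KU) (deg_exchange e_sym).
  have : 3 * #|K1 :\: K| <= \sum_(v in K1 :\: K) (deg e K v + deg e (K1 :\: K) v).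
    rewrite mulnC -sum_nat_const; apply: leq_sum => v vK1K.
    have := deg_setID e K1 K v; rewrite (setIidPr KU) => <-.
    by move: vK1K; rewrite inE => /andP[vK vK1]; apply: nRdeg => //; apply: contra vK; exact: (subsetP RK).
  rewrite big_split /= -/(e2 e (K1 :\: K)).
  have := cardsID K K1; rewrite (setIidPr KU); lia.
have [E eE] : exists E, e2 e K1 = 2 * E.
  by exists (e2 e K1)./2; rewrite mul2n even_halfK ?e2_even.
have K1gt0 : 0 < #|K1| by rewrite card_gt0; apply: contraNneq K0 => K10; rewrite K10 subset0 in KU.
have dlt v : v \in K1 -> deg e K1 v < #|K1|.
  move=> vK; rewrite -(deg_setD1_self e_irr); apply: leq_ltn_trans (deg_le_card _ _ _) _.
  by rewrite [X in _ < X](cardsD1 v) vK.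
(* Absorbing [v] must leave fewer edges than vertices, that is [E - deg v <= #|K1| - 2]. *)
have dR v : v \in R -> E + 2 <= #|K1| + deg e K1 v.
  move=> vR; have vK : v \in K1 by move: vR; rewrite inE => /andP[].
  have cK : #|K1| = (#|K1 :\ v|).+1 by rewrite (cardsD1 v) vK.
  have := noabs (v, K1 :\ v); rewrite /= vR subxx /=.
  have := e2_setD1 e_sym e_irr vK.
  have [->|K1v] := eqVneq (K1 :\ v) set0; first by have := dlt v vK; rewrite e2_set0; lia.
  by move=> eD /= /negbT; rewrite -ltnNge; lia.
have sumE : 3 * (#|K1| - #|R|) + #|R| * (E + 2 - #|K1|) <= 2 * E.
  have RK1 : R \subset K1 by apply: subset_trans KU.
  rewrite -eE /e2 (big_setID R) /= (setIidPr RK1) addnC leq_add //.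
    by rewrite -sum_nat_const; apply: leq_sum => v /dR; lia.
  rewrite mulnC -(_ : #|K1 :\: R| = #|K1| - #|R|); last by rewrite cardsD (setIidPr RK1).
  by rewrite -sum_nat_const; apply: leq_sum => v; rewrite inE => /andP[vR vK]; apply: nRdeg.
have [v vR] : exists v, v \in R.
  case: cU => _ /(_ D xD); case; last first.
    by move=> y yD [z zU eyz]; exists z; rewrite inE /K1 zU; apply/deg_gt0P; exists y; rewrite // e_sym.
  rewrite properEneq DU andbT; apply/eqP => DUe.
  by move: K1gt0; rewrite /K1 DUe setDv cards0.
have Rgt0 : 0 < #|R| by rewrite card_gt0; apply/set0Pn; exists v.
have RK1 : R \subset K1 by apply: subset_trans KU.
have RleK1 := subset_leq_card RK1.
have dv := dR v vR; have dv' := dlt v (subsetP RK1 v vR).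
(* Put [t = E - #|K1|] and [m = #|R|]. The degree sum gives [(#|K1| - m) + (m - 2) * t <= 0], so
   [R = K1] if [m >= 2]. If [m = 1] it gives [#|K1| <= t + 1], against [t + 2 <= deg v < #|K1|]. *)
have eqRK1 : R = K1.
  apply/eqP; rewrite eqEcard RK1 /=.
  rewrite eE in eK1; move: (#|R|) (#|K1|) (deg e K1 v) Rgt0 RleK1 K1gt0 dv dv' sumE eK1.
  move=> m k d m0 mk k0 dv dv' sumE eK1; have [t Et] : exists t, E = k + t by exists (E - k); lia.
  subst E; rewrite (_ : k + t + 2 - k = t + 2) in sumE; last lia.
  rewrite leqNgt; apply/negP => km.
  have [m1|m2] : m = 1 \/ 2 <= m by lia.
    by subst m; lia.
  by have := leq_mul m2 (leqnn t); lia.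
have [c [c2 uc cK]] : exists c, [/\ 2 < size c, ucycle e c & {subset c <= K1}].
  apply: min_degree2_cycle => //; first by rewrite -card_gt0.
  by move=> y yK; have := dR y; rewrite eqRK1 => /(_ yK); lia.
exists D, c; split=> //.
- rewrite c2 /=; apply: leq_trans Un; case/andP: uc => _ uc; rewrite -(card_uniqP uc).
  by apply: subset_leq_card; apply/subsetP.
- by move=> y yD; apply: near_weaken (nD y yD) => //; apply: leq_addr.
- move=> y /cK; rewrite -eqRK1 inE => /andP[_ /deg_gt0P[z zD eyz]].
  by exists z; rewrite // e_sym.
Qed.

End Absorption.

(** * Cycles closed through a connected set *)

Section Attached.
Variables (T : finType) (e : rel T).
Hypotheses (e_sym : symmetric e) (e_irr : irreflexive e).
Implicit Types (U V W X D K P : {set T}) (x y z v : T) (c p : seq T).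

Lemma conn_connect x X y : conn e x X -> y \in X ->
  connect [rel a b | [&& e a b, a \in X & b \in X]] x y.
Proof.
move=> [xX cX] yX; set r := rel_of_simpl _; pose D := [set z in X | connect r x z].
have [DX|DX] := eqVneq D X; first by move: yX; rewrite -DX inE => /andP[].
have xD : x \in D by rewrite inE xX connect0.
case: (cX D xD).
  by rewrite properEneq DX; apply/subsetP => z; rewrite inE => /andP[].
move=> z; rewrite inE => /andP[zX xz] [w]; rewrite inE => /andP[wD wX] ezw.
case/negP: wD; rewrite inE wX (connect_trans xz) //; apply: connect1.
by rewrite /r /= ezw zX wX.
Qed.

Lemma conn_path x X y z : conn e x X -> y \in X -> z \in X ->
  exists p, [/\ path e y p, last y p = z, uniq (y :: p) & {subset y :: p <= X}].
Proof.
move=> cX yX zX; set r := [rel a b | [&& e a b, a \in X & b \in X]].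
have rC : connect_sym r.
  by apply: sym_connect_sym => a b; rewrite /r /= e_sym [(a \in _) && _]andbC.
have : connect r y z.
  by apply: (@connect_trans _ _ x); [rewrite rC|]; exact: conn_connect.
case/connectP => p0 pp0 ->; case: (shortenP pp0) => p pp up _; exists p; split=> //.
  by apply: sub_path pp => a b /and3P[].
elim: p y {pp0 up} pp yX => [|w p IHp] y /=; first by move=> _ yX v; rewrite inE => /eqP->.
by move=> /andP[/and3P[_ _ wX] pp] yX v; rewrite inE => /orP[/eqP->//|]; apply: IHp.
Qed.

Lemma bipartite_path (chi : T -> bool) x p : (forall a b, e a b -> chi a != chi b) ->
  path e x p -> chi (last x p) = chi x (+) odd (size p).
Proof.
move=> bip; elim: p x => [|y p IHp] x /=; first by rewrite addbF.
by move=> /andP[/bip xy /IHp->]; move: xy; case: (chi x) (chi y) (odd _) => [] [] [].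
Qed.

Lemma bipartite_cycle_even (chi : T -> bool) c : (forall a b, e a b -> chi a != chi b) ->
  cycle e c -> ~~ odd (size c).
Proof.
move=> bip; case: c => // x p /(bipartite_path bip).
by rewrite last_rcons size_rcons /=; case: (chi x) (odd (size p)) => [] [].
Qed.

(* The two arcs of [c] between antipodal-but-one vertices have lengths [k - 1] and [k + 1];
   closing both by the same path through [D] gives lengths differing by two. *)
Lemma cycles_of_attached_cycle (chi : T -> bool) r x D c : (forall a b, e a b -> chi a != chi b) ->
  (forall y, y \in D -> near e x D r y) ->
  2 < size c -> ucycle e c -> {subset c <= ~: D} ->
  (forall y, y \in c -> exists2 z, z \in D & e z y) ->
  exists m c1 c2, [/\ 2 <= m <= size c + r,
    ucycle e c1 /\ size c1 = 2 * m, ucycle e c2 /\ size c2 = 2 * m + 2,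
    {subset c1 <= D :|: [set z in c]} & {subset c2 <= D :|: [set z in c]}].
Proof.
move=> bip nD c2 /andP[cc uc] cD adj.
have evc := bipartite_cycle_even bip cc.
have [k szc] : exists k, size c = 2 * k.
  by exists (size c)./2; rewrite mul2n even_halfK.
have k2 : 1 < k by lia.
case def_c: c c2 szc => [//|u c'] c2 szc.
(* [a'] has [k - 2] vertices and [b] has [k], so the arcs between [u] and [v] have lengths [k - 1]
   and [k + 1]. *)
have [a' [v [b [def_c' sza]]]] : exists a' v b, c' = rcons a' v ++ b /\ (size a').+2 = k.
  move: szc; rewrite /=; case: k k2 => [//|[//|k]] _ szc.
  exists (take k c'), (nth u c' k), (drop k.+1 c'); split.
    by rewrite -take_nth ?cat_take_drop //; lia.
  by rewrite size_take; case: ltnP; lia.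
have szb : size b = k by move: szc; rewrite def_c' /= size_cat size_rcons; lia.
have uc0 : u \in c by rewrite def_c inE eqxx.
have vc0 : v \in c by rewrite def_c def_c' inE mem_cat mem_rcons inE eqxx orbT.
have [y yD eyu] := adj u uc0; have [z zD ezv] := adj v vc0.
have [P [PD cP yP Pr]] := nD y yD; have [Q [QD cQ zQ Qr]] := nD z zD.
have [p [pp lp up pPQ]] : exists p, [/\ path e y p, last y p = z, uniq (y :: p) & {subset y :: p <= P :|: Q}].
  by apply: (conn_path (connU cP cQ)); rewrite inE ?yP ?zQ ?orbT.
have szp : size (y :: p) <= 2 * r.
  rewrite -(card_uniqP up); apply: leq_trans (_ : #|P :|: Q| <= _); last first.
    by apply: leq_trans (leq_card_setU P Q) _; rewrite mul2n -addnn leq_add.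
  by apply: subset_leq_card; apply/subsetP.
have ypD : {subset y :: p <= D}.
  by move=> w /pPQ; rewrite inE => /orP[/(subsetP PD)|/(subsetP QD)].
have disj w : w \in c -> w \notin y :: p.
  by move/cD; rewrite inE; apply: contra; exact: ypD.
move: cc uc; rewrite def_c def_c' /= rcons_cat cat_path rcons_path last_rcons rcons_path.
move=> /and3P[/andP[pa eav] pb ebu] /andP[uca]; rewrite cat_uniq => /and3P[ua ab ub].
(* The short arc, from [u] to [v], is closed by the path through [D] reversed; the long one, from
   [v] to [u], by the path itself. *)
pose c1 := u :: rcons a' v ++ rev (y :: p).
pose c2' := v :: b ++ u :: (y :: p).
have cyc1 : ucycle e c1.
  have rp : path e z (rev (belast y p)).
    by rewrite -lp rev_path; apply: sub_path pp => s t; rewrite e_sym.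
  rewrite /ucycle /c1 [y :: p]lastI lp rev_rcons; apply/andP; split.
    rewrite /= rcons_cat cat_path rcons_path last_rcons pa eav /= rcons_path rp (e_sym v) ezv /=.
    suff -> : last z (rev (belast y p)) = y by [].
    by rewrite -lp; case: (p) => //= w p'; rewrite rev_cons last_rcons.
  rewrite -rev_rcons -lp -lastI cons_uniq mem_cat negb_or cat_uniq rev_uniq ua up /= andbT.
  rewrite mem_rev disj // andbT; apply/andP; split.
    by move: uca; rewrite mem_cat negb_or => /andP[].
  apply/hasPn => w; rewrite mem_rev => wp; apply: contraL wp => wa; apply: disj.
  by rewrite def_c def_c' inE mem_cat wa orbT.
have cyc2 : ucycle e c2'.
  have evz : e (last y p) v by rewrite lp.
  rewrite /ucycle /c2'; apply/andP; split.
    by rewrite /= rcons_cat cat_path /= rcons_path pb ebu (e_sym u) eyu pp evz.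
  have [/negPf uNv uNb] : u != v /\ u \notin b.
    by move: uca; rewrite mem_cat mem_rcons inE !negb_or => /andP[/andP[-> _] ->].
  have vb : v \notin b.
    by apply: contraNN ab => vb; apply/hasP; exists v; rewrite // mem_rcons inE eqxx.
  have bp : ~~ has (mem b) (u :: y :: p).
    apply/hasPn => w; rewrite in_cons => /orP[/eqP->//|wp]; apply: contraL wp => /= wb; apply: disj.
    by rewrite def_c def_c' inE mem_cat wb !orbT.
  rewrite cons_uniq mem_cat cat_uniq bp ub cons_uniq up disj // (negPf vb) andbT /=.
  by rewrite in_cons eq_sym uNv disj.
have sz1 : size c1 = k + size (y :: p) by rewrite /c1 /= size_cat size_rev size_rcons /=; clear -sza; lia.
have sz2 : size c2' = k + size (y :: p) + 2 by rewrite /c2' /= size_cat /=; clear -szb; lia.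
have ev1 : ~~ odd (size c1) by case/andP: cyc1 => /(bipartite_cycle_even bip).
have [m szm] : exists m, size c1 = 2 * m.
  by exists (size c1)./2; rewrite mul2n even_halfK.
have szp0 : 0 < size (y :: p) by [].
have szc' : (size (rcons a' v ++ b)).+1 = 2 * k by rewrite size_cat size_rcons szb; clear -sza; lia.
exists m, c1, c2'; split.
- by rewrite /= szc'; clear -sz1 szm szp szp0 k2; lia.
- by split.
- by split=> //; rewrite sz2 -sz1 szm.
- move=> w; rewrite !inE mem_cat mem_rev !inE.
  case/or4P => [->|h|h|h]; rewrite ?orbT //.
  + by rewrite mem_cat h !orbT.
  + by rewrite ypD // inE h.
  + by rewrite ypD // inE h orbT.
- move=> w; rewrite !inE mem_cat !inE.
  case/or3P => [h|h|/or3P[h|h|h]]; rewrite ?h ?orbT //.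
  + by rewrite mem_cat mem_rcons inE h !orbT.
  + by rewrite mem_cat h !orbT.
  + by rewrite ypD // inE h.
  + by rewrite ypD // inE h orbT.
Qed.

End Attached.

(** * Balls and expansion in graphs of average degree above four *)

Section Balls.
Variables (T : finType) (e : rel T).
Hypotheses (e_sym : symmetric e) (e_irr : irreflexive e).
Implicit Types (U V W X D K P B : {set T}) (x y z v : T).

Definition grow V B := B :|: [set y in V | 0 < deg e B y].
Definition ball V x i := iter i (grow V) [set x].

Lemma ballS V x i : ball V x i.+1 = grow V (ball V x i). Proof. by []. Qed.

Lemma ball_sub V x i : x \in V -> ball V x i \subset V.
Proof.
move=> xV; elim: i => [|i IHi]; first by rewrite sub1set.
by rewrite ballS subUset IHi; apply/subsetP => y; rewrite inE => /andP[].
Qed.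

Lemma ball_incr V x i : ball V x i \subset ball V x i.+1.
Proof. exact: subsetUl. Qed.

Lemma ball_center V x i : x \in ball V x i.
Proof. by elim: i => [|i IHi]; [exact: set11 | exact: (subsetP (ball_incr V x i))]. Qed.

Lemma mem_ballS V x i y z : y \in ball V x i -> z \in V -> e y z -> z \in ball V x i.+1.
Proof.
move=> yB zV eyz; rewrite ballS !inE zV; apply/orP; right; apply/deg_gt0P.
by exists y; rewrite // e_sym.
Qed.

(** Apart from [y] the connecting set stays in the previous ball. It therefore avoids every other
    vertex of the last shell, as [sparse_between_balls] requires. *)
Lemma mem_ball_near V x i y : y \in ball V x i.+1 -> near e x (y |: ball V x i) i.+2 y.
Proof.
elim: i y => [|i IHi] y.
  rewrite ballS /= !inE => /orP[/eqP->|/andP[_ /deg_gt0P[z]]].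
    by exists [set x]; split; rewrite ?inE ?cards1 ?subsetUl //; apply: conn1.
  rewrite inE => /eqP-> eyx.
  exists (y |: [set x]); split; rewrite ?setU11 //.
    by apply: (conn_setU1 (conn1 e x)); rewrite ?inE // e_sym.
  by rewrite cardsU1 cards1; case: (_ \notin _).
rewrite ballS inE => /orP[/IHi|].
  by apply: near_weaken; rewrite // setUS // ball_incr.
rewrite inE => /andP[_ /deg_gt0P[z zB eyz]].
apply: (near_setU1 (y := z)); last by rewrite e_sym.
by apply: near_weaken (IHi z zB); rewrite // subUset sub1set zB ball_incr.
Qed.

Lemma ball_near V x i y : y \in ball V x i -> near e x (ball V x i) i.+1 y.
Proof.
case: i => [|i].
  by move=> /set1P->; exists [set x]; split; rewrite ?set11 ?cards1 //; apply: conn1.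
move=> yB; apply: near_weaken (mem_ball_near yB) => //.
by rewrite subUset sub1set yB ball_incr.
Qed.

Section Growth.
Variables (U : {set T}) (j : nat).
Hypothesis no_dense : forall K, K \subset U -> K != set0 -> #|K| <= 2 * j + 3 -> e2 e K < 2 * #|K|.

(** Vertices of the shell are added one at a time. If [v] had two neighbours in [D], connected sets
    of at most [i + 2] vertices joining them to [x] would form with [v] a set of at most
    [2 * i + 5 <= 2 * j + 3] vertices with as many edges: a tree on the union and two edges at [v].
    So each [v] brings at most one edge. *)
Lemma sparse_between_balls x i D : x \in U -> i < j ->
  ball U x i \subset D -> D \subset ball U x i.+1 ->
  e2 e (ball U x i) + 2 <= 2 * #|ball U x i| -> e2 e D + 2 <= 2 * #|D|.
Proof.
move=> xU ij; set B := ball U x i => BD DB' eB.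
elim: {D}_.+1 {-2}D (ltnSn #|D|) BD DB' => // n IHn D Dn BD DB'.
have [<-//|nBD] := eqVneq B D.
have /subsetPn[v vD vB] : ~~ (D \subset B).
  by apply: contra nBD => DB; rewrite eqEsubset BD.
have cD : #|D| = #|D :\ v|.+1 by rewrite (cardsD1 v) vD.
have BDv : B \subset D :\ v by rewrite subsetD1 BD.
have eDv : e2 e (D :\ v) + 2 <= 2 * #|D :\ v|.
  by apply: IHn => //; [lia | apply: subset_trans DB'; apply: subD1set].
rewrite (e2_setD1 e_sym e_irr vD) cD.
suff : deg e D v <= 1 by lia.
rewrite leqNgt degE; apply/negP => /card_gt1P[z [w]]; rewrite !inE.
case=> /andP[zD evz] /andP[wD evw] zw.
have P y : y \in D -> e v y -> exists P, [/\ P \subset U, v \notin P, conn e x P, y \in P & #|P| <= i.+2].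
  move=> yD evy; have yB' := subsetP DB' _ yD.
  have [P [PB cP yP Pi]] := mem_ball_near yB'; exists P; split=> //.
    by apply: subset_trans PB _; rewrite subUset sub1set ball_sub // (subsetP (ball_sub _ xU) _ yB').
  apply/negP => /(subsetP PB); rewrite inE (negPf vB) orbF inE => /eqP vy.
  by rewrite vy e_irr in evy.
have [P1 [P1U vP1 cP1 zP1 P1i]] := P z zD evz; have [P2 [P2U vP2 cP2 wP2 P2i]] := P w wD evw.
have vX : v \notin P1 :|: P2 by rewrite inE negb_or vP1.
have := conn_e2 e_sym e_irr (connU cP1 cP2).
have := @no_dense (v |: (P1 :|: P2)).
have vU : v \in U by rewrite (subsetP (ball_sub i.+1 xU)) // (subsetP DB').
rewrite !subUset sub1set vU P1U P2U; rewrite -card_gt0 cardsU1 vX => /(_ isT isT).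
have : #|P1 :|: P2| <= #|P1| + #|P2| := leq_card_setU P1 P2.
rewrite (@e2_setD1 _ _ e_sym e_irr (v |: (P1 :|: P2)) v) ?setU11 // setU1K //.
have : 1 < deg e (v |: (P1 :|: P2)) v.
  rewrite degE; apply/card_gt1P; exists z, w; split=> //; first by rewrite !inE zP1 evz orbT.
  by rewrite !inE wP2 evw !orbT.
rewrite /=; set X := P1 :|: P2; move: (deg _ _ _) (e2 e (v |: X)) (e2 e X) #|X|.
by move: #|P1| #|P2| P1i P2i ij; clear; lia.
Qed.

(** The degrees in [B] add up to at least [3 * #|B|] and at most [#|B| - 1] edges lie inside, so at
    least [2 * #|B| + 1] edges meet [B]. They all lie in the next ball, which also spans fewer edges
    than vertices. *)
Lemma ball_expo x i : (forall y, y \in U -> 2 < deg e U y) -> x \in U -> i <= j ->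
  2 ^ i <= #|ball U x i| /\ e2 e (ball U x i) + 2 <= 2 * #|ball U x i|.
Proof.
move=> dU xU; elim: i => [|i IHi] ij.
  by rewrite cards1 /e2 big_set1 /deg big_set1 e_irr.
case: (IHi (ltnW ij)) => Bi eB.
have eB' := sparse_between_balls xU ij (ball_incr U x i) (subxx _) eB; split=> //.
move: (ball_incr U x i) eB'; set B := ball U x i in Bi eB *; set B' := ball U x i.+1 => BB'.
have BU : B \subset U by apply: ball_sub.
have B'U : B' \subset U by apply: ball_sub.
rewrite (e2_setID e_sym BB').
have s1 : 3 * #|B| <= e2 e B + \sum_(y in B) deg e (B' :\: B) y.
  rewrite /e2 -big_split mulnC -sum_nat_const /=; apply: leq_sum => y yB.
  have := deg_setID e B' B y; rewrite (setIidPr BB') => <-.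
  apply: leq_trans (dU y (subsetP BU y yB)) _; rewrite !degE; apply: subset_leq_card.
  apply/subsetP => z; rewrite in_set => /andP[zU eyz]; rewrite in_set eyz andbT.
  exact: mem_ballS yB zU eyz.
have s2 : #|B' :\: B| <= \sum_(y in B) deg e (B' :\: B) y.
  rewrite (deg_exchange e_sym) -sum1_card; apply: leq_sum => y; rewrite /B' ballS !inE.
  by case: (y \in B) => //= /andP[].
have := cardsID B B'; rewrite (setIidPr BB') expnS; lia.
Qed.

End Growth.

(* Balls would otherwise double at each step. *)
Lemma small_dense_subset U j : U != set0 -> (forall y, y \in U -> 2 < deg e U y) -> #|U| < 2 ^ j ->
  exists K, [/\ K \subset U, K != set0, #|K| <= 2 * j + 3 & 2 * #|K| <= e2 e K].
Proof.
move=> /set0Pn[x xU] dU Uj.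
case: (pickP (fun K => [&& K \subset U, K != set0, #|K| <= 2 * j + 3 & 2 * #|K| <= e2 e K])).
  by move=> K /and4P[]; exists K.
move=> noK; case: (@ball_expo U j _ x j dU xU (leqnn j)) => [K KU K0 Kj|Bj _].
  by rewrite ltnNge; have := noK K; rewrite KU K0 Kj /= => ->.
have := subset_leq_card (ball_sub j xU); lia.
Qed.

End Balls.

(** The cube is taken because [(4 / 3) ^ 3 = 64 / 27] exceeds 2: losing a quarter of the vertices
    lowers the logarithm by at least one. *)
Lemma trunc_log_cube_lt a n : 0 < a -> 4 * a <= 3 * n -> trunc_log 2 (a ^ 3) < trunc_log 2 (n ^ 3).
Proof.
move=> a0 an; apply: trunc_log_max => //; rewrite expnS.
have : 2 ^ trunc_log 2 (a ^ 3) <= a ^ 3 by apply: trunc_logP; rewrite ?expn_gt0 ?a0.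
have : (4 * a) ^ 3 <= (3 * n) ^ 3 by rewrite leq_exp2r.
rewrite !expnMn (_ : 4 ^ 3 = 64) // (_ : 3 ^ 3 = 27) //.
by lia.
Qed.

(** Each step adds at least [1 / g] of the current value, so [g] steps double the value they start
    from. *)
Lemma iterated_growth (b : nat -> nat) g j : 0 < g -> (forall i, b i <= b i.+1) ->
  (forall i, i < g * j -> b i <= g * (b i.+1 - b i)) -> 2 ^ j * b 0 <= b (g * j).
Proof.
move=> g0 mono; have monoD i k : b i <= b (i + k).
  by elim: k => [|k IHk]; rewrite ?addn0 // addnS (leq_trans IHk).
elim: j => [|j IHj] grow; first by rewrite muln0 mul1n.
have {}IHj : 2 ^ j * b 0 <= b (g * j) by apply: IHj => i ij; apply: grow; rewrite mulnS ltn_addl.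
have step k : k <= g -> g * b (g * j) + k * b (g * j) <= g * b (g * j + k).
  elim: k => [|k IHk] kg; first by rewrite mul0n !addn0.
  have lt : g * j + k < g * j.+1 by rewrite mulnS addnC ltn_add2r.
  have := leq_mul (leqnn g) (mono (g * j + k)).
  have := IHk (ltnW kg); have := grow _ lt; have := monoD (g * j) k.
  by rewrite addnS mulSn mulnBr; clear; lia.
have := step g (leqnn g); rewrite -mulnDr leq_pmul2l // mulnS [g + _]addnC expnS.
by move: IHj; clear; lia.
Qed.

(** * Expansion of a minimal graph above the density threshold *)

Section Expansion.
Variables (T : finType) (e : rel T).
Hypotheses (e_sym : symmetric e) (e_irr : irreflexive e).
Implicit Types (V W X Y Z D K : {set T}) (x y z v : T).

Variables (p L : nat).
Hypotheses (p_gt0 : 0 < p) (L_gt0 : 0 < L).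

(* The density threshold [4 + 1/p + O(log n) / (pL)] grows slowly with the number of vertices
   (scaled by [pL] to stay in [nat]); a minimal set above the threshold has no small separator. *)
Definition threshold n := (4 * p * L + L + trunc_log 2 (n ^ 3)) * n.

Variable U : {set T}.
Hypotheses (U_neq0 : U != set0) (U_log : trunc_log 2 (#|U| ^ 3) <= L).
Hypothesis U_dense : threshold #|U| <= p * L * e2 e U.
Hypothesis U_min : forall W, W \proper U -> W != set0 -> p * L * e2 e W < threshold #|W|.

Lemma threshold_le n : n <= #|U| -> threshold n <= (4 * p * L + L + trunc_log 2 (#|U| ^ 3)) * n.
Proof.
move=> nU; rewrite leq_mul2r leq_add2l; apply/orP; right.
by apply: leq_trunc_log; case: n nU => // n nU; rewrite leq_exp2r.
Qed.

Lemma sparse_proper W : W \proper U -> p * L * e2 e W <= threshold #|W|.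
Proof.
have [->|W0 WU] := eqVneq W set0; first by rewrite e2_set0 muln0.
by rewrite ltnW // U_min.
Qed.

(** Bounds the coefficient in [threshold #|U|], since the logarithm is at most [L]. *)
Let M := (4 * p + 2) * L.

Definition bdry K X := [set y in (U :\: K) :\: X | 0 < deg e X y].

(** Every edge of [U] lies in [V], the union of [X], its boundary and [K], or in [U :\: X]; the two
    overlap in the boundary and [K]. Minimality bounds the density of both, and [V], having at most
    three quarters of the vertices, has a coefficient smaller by at least one. The overlap must pay
    for this gain of [#|V|]. *)
Lemma expansion X K : X \subset U :\: K -> K \subset U ->
  4 * (#|X| + #|bdry K X| + #|K|) <= 3 * #|U| ->
  #|X| + #|bdry K X| + #|K| <= M * (#|bdry K X| + #|K|).
Proof.
move=> XUK KU; rewrite /bdry; set bd := [set y in _ | _] => small.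
have U0 : 0 < #|U| by rewrite card_gt0.
have M1 : 0 < M by rewrite /M muln_gt0 L_gt0 andbT addn2.
have [X0|X0] := eqVneq X set0.
  by move: small; rewrite X0 cards0 add0n => _; rewrite leq_pmull.
have XU : X \subset U by apply: subset_trans XUK (subsetDl _ _).
have dXbd : [disjoint X & bd].
  by apply/pred0P => y /=; apply/negP => /andP[yX]; rewrite !inE yX.
have dXK : [disjoint X :|: bd & K].
  apply/pred0P => y /=; apply/negP => /andP[/setUP[/(subsetP XUK)|]].
    by rewrite inE => /andP[/negPf->].
  by rewrite !inE => /andP[/andP[_ /andP[/negPf->]]].
pose V := X :|: bd :|: K.
have cV : #|V| = #|X| + #|bd| + #|K| by rewrite !cardsU !disjoint_setI0 // cards0 !subn0.
have VU : V \subset U.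
  by rewrite !subUset XU KU andbT; apply/subsetP => y; rewrite !inE => /andP[/andP[_ /andP[]]].
have pV : V \proper U by rewrite properEcard VU cV; move: small U0; clear; lia.
have pUX : U :\: X \proper U.
  by rewrite properEcard subsetDl cardsD (setIidPr XU); move: X0 U0; rewrite -card_gt0; clear; lia.
have cover : e2 e U <= e2 e V + e2 e (U :\: X).
  apply: e2_cover => //.
    by apply/subsetP => y yU; rewrite /V !inE yU andbT; case: (y \in X); rewrite ?orbT.
  move=> y z; rewrite inE [y \in U :\: X]inE negb_and negbK => /andP[/orP[yX|yU] yV]; last first.
    by rewrite (subsetP VU _ yV) in yU.
  rewrite inE => /andP[zV]; rewrite inE => /andP[zX zU]; apply: contra zV => eyz.
  rewrite /V !inE (negPf zX) zU; case: (z \in K) => //=; rewrite ?orbT //= orbF.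
  by apply/deg_gt0P; exists y; rewrite // e_sym.
pose l := trunc_log 2 (#|U| ^ 3).
have X1 : 0 < #|X| by rewrite card_gt0.
have lt : trunc_log 2 (#|V| ^ 3) < l.
  by apply: trunc_log_cube_lt; rewrite cV // -addnA ltn_addr.
have cUX : #|U :\: X| + #|X| = #|U| by rewrite addnC -(cardsID X U) (setIidPr XU).
pose C := 4 * p * L + L + l.
have CM : C <= M by rewrite /C /M mulnDl mul2n -addnn addnA leq_add2l U_log.
have eV : p * L * e2 e V + #|V| <= C * #|V|.
  apply: leq_trans (_ : threshold #|V| + #|V| <= _); first by rewrite leq_add2r sparse_proper.
  by rewrite /threshold -mulSnr leq_mul2r -addnS leq_add2l lt orbT.
have eX : p * L * e2 e (U :\: X) <= C * #|U :\: X|.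
  exact: leq_trans (sparse_proper pUX) (threshold_le (subset_leq_card (subsetDl U X))).
have eU : C * #|U| <= p * L * e2 e V + p * L * e2 e (U :\: X).
  by apply: leq_trans U_dense _; rewrite -mulnDr leq_mul2l cover orbT.
rewrite -cV; apply: leq_trans (_ : C * (#|bd| + #|K|) <= _); last by rewrite leq_mul2r CM orbT.
have eC : C * #|U| + C * (#|bd| + #|K|) = C * #|V| + C * #|U :\: X|.
  by rewrite -!mulnDr; congr (_ * _); move: cV cUX; clear; lia.
by move: eC eU eX eV; clear; lia.
Qed.

(** Deleting a vertex lowers the threshold by at least [(4 * p + 1) * L], but one of degree at most
    2 accounts for at most [4 * p * L] of [p * L * e2 e U]. *)
Lemma threshold_min_deg x : x \in U -> 2 < deg e U x.
Proof.
move=> xU; have cU : #|U| = #|U :\ x|.+1 by rewrite (cardsD1 x) xU.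
have pU : U :\ x \proper U by rewrite properD1.
pose C := 4 * p * L + L + trunc_log 2 (#|U| ^ 3).
have := leq_trans (sparse_proper pU) (threshold_le (subset_leq_card (subD1set U x))).
have : C * #|U| <= _ := U_dense; rewrite -/C (e2_setD1 e_sym e_irr xU) cU mulnS mulnDr => H1 H2.
have : C <= p * L * (2 * deg e U x) by move: H1 H2; clear; lia.
rewrite ltnNge => CD; apply/negP => d2; have : 4 * p * L + L <= p * L * (2 * 2).
  apply: leq_trans (leq_trans (leq_addr _ _) CD) _.
  by rewrite leq_mul2l leq_mul2l d2 !orbT.
by move: L_gt0; clear; lia.
Qed.

(** If no edge left [D], both [D] and [U :\: D] would fall below the coefficient of [U], and hence
    so would [U]. *)
Lemma threshold_conn x : x \in U -> conn e x U.
Proof.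
move=> xU; split=> // D xD DU.
case: (pickP (fun q : T * T => [&& q.1 \in D, q.2 \in U :\: D & e q.1 q.2])) => [[y z] /and3P[]|nD].
  by move=> yD zD eyz; exists y => //; exists z.
have sDU := proper_sub DU.
have D0 : D != set0 by apply/set0Pn; exists x.
have UD0 : U :\: D != set0 by rewrite -subset0 subDset setU0; case/andP: DU.
have pUD : U :\: D \proper U.
  by rewrite properEneq subsetDl andbT; apply: contraTneq xD => UD; move: xU; rewrite -UD inE => /andP[].
have cover : e2 e U <= e2 e D + e2 e (U :\: D).
  apply: e2_cover => //; first by apply/subsetP => y yU; rewrite !inE yU; case: (y \in D).
  move=> y z /setDP[yD _] /setDP[zUD _].
  by have := nD (y, z); rewrite /= yD zUD /= => ->.
pose C := 4 * p * L + L + trunc_log 2 (#|U| ^ 3).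
have eC : C * #|U| = C * #|D| + C * #|U :\: D|.
  by rewrite -mulnDr -{1}(cardsID D U) (setIidPr sDU).
have lD := leq_trans (U_min DU D0) (threshold_le (subset_leq_card sDU)).
have lUD := leq_trans (U_min pUD UD0) (threshold_le (subset_leq_card (subsetDl U D))).
have : C * #|U| <= p * L * e2 e D + p * L * e2 e (U :\: D).
  by apply: leq_trans U_dense _; rewrite -mulnDr leq_mul2l cover orbT.
by move: eC lD lUD; rewrite /C; clear; lia.
Qed.

Lemma bd_ball x K i : bdry K (ball e (U :\: K) x i) = ball e (U :\: K) x i.+1 :\: ball e (U :\: K) x i.
Proof.
apply/setP => y; rewrite ballS /bdry /grow; move: (ball _ _ _ _) => B.
by rewrite in_set !in_setD in_setU [in RHS]in_set in_setD; case: (y \in B); rewrite /= ?andbF.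
Qed.

Variables (q j : nat).
Hypotheses (q_gt0 : 0 < q) (U_lt : #|U| < 2 ^ j).
(** From [g * q] vertices on, the term [M * #|K|] in [expansion] is at most half of [#|X|], so the
    boundary has at least [#|X| / g] vertices. *)
Let g := 2 * M.

(* A union of components of [U :\: K] which is not almost everything is small, so some
   component has at least [g * q] vertices. *)
Lemma ball_start K : K \subset U -> #|K| <= q -> 4 * (3 * M + 1) * q <= #|U| ->
  exists2 x, x \in U :\: K & g * q <= #|ball e (U :\: K) x (g * q)|.
Proof.
move=> KU Kq Ubig.
have M1 : 0 < M by rewrite /M muln_gt0 L_gt0 andbT addn2.
pose closed Z := [&& Z \subset U :\: K, bdry K Z == set0 & 4 * (#|Z| + #|K|) <= 3 * #|U|].
have closed0 : closed set0.
  apply/and3P; split; first exact: sub0set.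
    by apply/eqP/setP => y; rewrite !inE /deg big_set0 andbF.
  by rewrite cards0; move: Kq Ubig; clear; lia.
case: (@arg_maxnP _ set0 closed (fun Z => #|Z|) closed0) => Z /and3P[ZU /eqP Z0 Zsmall] Zmax.
have Zq : #|Z| <= M * q.
  have := expansion ZU KU; rewrite Z0 cards0 addn0 => /(_ Zsmall).
  by have := leq_mul (leqnn M) Kq; clear; lia.
have [x xUK xZ] : exists2 x, x \in U :\: K & x \notin Z.
  apply/subsetPn; apply/negP => /subset_leq_card; rewrite cardsD (setIidPr KU).
  by move: Zq Kq Ubig q_gt0; clear; lia.
exists x => //.
(* A ball that stalls below [g * q] vertices is closed, and adding it to [Z] contradicts the
   maximality of [Z]. *)
suff grow i : minn i (g * q) <= #|ball e (U :\: K) x i| by have := grow (g * q); rewrite minnn.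
elim: i => [|i IHi]; first by rewrite min0n.
have [big|small] := leqP (g * q) #|ball e (U :\: K) x i|.
  by apply: leq_trans (geq_minr _ _) (leq_trans big (subset_leq_card (ball_incr _ _ _ _))).
suff : ball e (U :\: K) x i \proper ball e (U :\: K) x i.+1.
  by move/proper_card; move: IHi small; clear; lia.
rewrite properE ball_incr /= -setD_eq0 -bd_ball; apply/negP => /eqP b0.
have xB := ball_center e (U :\: K) x i; move: b0 xB small.
have := ball_sub e i xUK; move: (ball _ _ _ _) => B BU B0 xB small.
have : closed (Z :|: B).
  apply/and3P; split; first by rewrite subUset ZU.
    apply/eqP/setP => y; rewrite [RHS]inE; apply/negbTE/negP.
    rewrite inE => /andP[/setDP[yU]]; rewrite inE negb_or => /andP[yZ yB] /deg_gt0P[z].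
    case/setUP => zZB eyz.
      by have : y \in bdry K Z; [rewrite !(inE, yU, yZ); apply/deg_gt0P; exists z | rewrite Z0 inE].
    by have : y \in bdry K B; [rewrite !(inE, yU, yB); apply/deg_gt0P; exists z | rewrite B0 inE].
  have := leq_of_leqif (leq_card_setU Z B); move: Zq Kq Ubig small; rewrite /g; clear; lia.
move/Zmax; apply/negP; rewrite -ltnNge; apply: proper_card; apply/properP.
by split; [exact: subsetUl | exists x; rewrite // inE xB orbT].
Qed.

(** Three phases. The ball reaches [g * q] vertices, then doubles every [g] steps until together
    with [K] it exceeds three quarters of [U]. After that its complements, read from larger to
    smaller radius, double every [g] steps, so within [g * j] steps they shrink below [g * q]. *)
Lemma giant_ball K : K \subset U -> #|K| <= q -> 4 * (3 * M + 1) * q <= #|U| ->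
  exists2 x, x \in U :\: K &
    #|U :\: ball e (U :\: K) x (g * q + 2 * (g * j))| <= g * q + q.
Proof.
move=> KU Kq Ubig; have [x xUK start] := ball_start KU Kq Ubig; exists x => //.
have M1 : 0 < M by rewrite /M muln_gt0 L_gt0 andbT addn2.
have g0 : 0 < g by rewrite /g muln_gt0.
have gE t : g * t = 2 * (M * t) := esym (mulnA _ _ _).
have MK : M * #|K| <= M * q by rewrite leq_mul2l Kq orbT.
pose B i := ball e (U :\: K) x i.
have BU i : B i \subset U :\: K by apply: ball_sub.
have Bsub a b : a <= b -> B a \subset B b.
  move/subnKC <-; elim: (b - a) => [|k IHk]; first by rewrite addn0.
  by rewrite addnS (subset_trans IHk) // ball_incr.
have Bmono a b : a <= b -> #|B a| <= #|B b| by move/Bsub/subset_leq_card.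
have cUK : #|U :\: K| + #|K| = #|U| by rewrite addnC -(cardsID K U) (setIidPr KU).
have cbd i : #|bdry K (B i)| = #|B i.+1| - #|B i|.
  by rewrite bd_ball cardsD (setIidPr _) // ball_incr.
have half : exists2 i, i <= g * q + g * j & 3 * #|U| < 4 * (#|B i| + #|K|).
  case: (leqP (4 * (#|B (g * q + g * j)| + #|K|)) (3 * #|U|)) => [small|]; last by exists (g * q + g * j).
  have : 2 ^ j * #|B (g * q + 0)| <= #|B (g * q + g * j)|.
    apply: (@iterated_growth (fun i => #|B (g * q + i)|)) => // [i|i ij]; rewrite addnS; first exact: Bmono.
    have leBE : #|B (g * q + i).+1| <= #|B (g * q + g * j)|.
      by apply: Bmono; rewrite -addnS leq_add2l.
    have startB : g * q <= #|B (g * q + i)| := leq_trans start (Bmono _ _ (leq_addr _ _)).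
    have := expansion (BU (g * q + i)) KU; rewrite cbd subnKC ?Bmono // => E.
    have {E} := E (leq_trans _ small); rewrite leq_mul2l leq_add2r leBE => /(_ isT).
    have {}startB : 2 * (M * q) <= #|B (g * q + i)| by rewrite -gE.
    rewrite mulnDr (gE (_ - _)); move: startB MK (Bmono _ _ (leqnSn (g * q + i))).
    by move: (M * (_ - _)) (M * q) (M * #|K|); clear; lia.
  rewrite addn0 => grow; have := subset_leq_card (BU (g * q + g * j)).
  have := leq_mul (leqnn (2 ^ j)) start; have : 2 ^ j <= 2 ^ j * (g * q) by rewrite leq_pmulr // muln_gt0 g0.
  by move: grow cUK U_lt; rewrite /B; clear; lia.
case: half => i ij half.
pose X k := (U :\: K) :\: B k.
have cX k : #|X k| + #|B k| + #|K| = #|U|.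
  by rewrite -cUK -(cardsID (B k) (U :\: K)) (setIidPr (BU k)) [X in X + _ = _]addnC.
(* No vertex of [X a.+1] has a neighbour in [B a], so its boundary lies in the shell between radii
   [a] and [a.+1]. *)
have bdX a : #|bdry K (X a.+1)| <= #|B a.+1| - #|B a|.
  rewrite -(setIidPr (Bsub _ _ (leqnSn a))) -cardsD; apply: subset_leq_card.
  apply/subsetP => y; rewrite in_set => /andP[/setDP[yUK yX] /deg_gt0P[z /setDP[zUK zB] eyz]].
  rewrite inE; apply/andP; split; last by move: yX; rewrite inE yUK andbT negbK.
  by apply: contra zB => yB; apply: mem_ballS yB zUK eyz.
have cend : #|X (i + g * j)| < g * q.
  rewrite ltnNge; apply/negP => cbig.
  have : 2 ^ j * #|X (i + g * j - 0)| <= #|X (i + g * j - g * j)|.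
    apply: (@iterated_growth (fun k => #|X (i + g * j - k)|)) => // [k|k kj].
      by apply/subset_leq_card/setDS/Bsub; rewrite leq_sub2l.
    have -> : i + g * j - k = (i + g * j - k.+1).+1 by move: kj; clear; lia.
    have ia : i <= i + g * j - k.+1 by move: kj; clear; lia.
    have : (i + g * j - k.+1).+1 <= i + g * j by move: kj; clear; lia.
    move: (i + g * j - k.+1) ia => a ia aj.
    have := expansion (subsetDl _ _ : X a.+1 \subset U :\: K) KU.
    have := bdX a; have := cX a; have := cX a.+1; have := Bmono _ _ (leqnSn a); have := Bmono _ _ ia.
    have : #|X (i + g * j)| <= #|X a.+1| by apply/subset_leq_card/setDS/Bsub.
    move: #|X a.+1| #|X a| #|B a| #|B a.+1| #|bdry K (X a.+1)| => x1 x0 b0 b1 d H1 H2 H3 H4 H5 H6 E.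
    have {E} E := E _; have : x1 + d + #|K| <= M * (d + #|K|).
      by apply: E; move: half H2 H3 H4 H5 H6 Kq Ubig; clear; lia.
    have : M * d <= M * (x0 - x1) by rewrite leq_mul2l; apply/orP; right; move: H3 H4 H5 H6; clear; lia.
    by rewrite mulnDr (gE (_ - _)); move: MK cbig H1; rewrite (gE q); move: (M * (_ - _)) (M * d) (M * q) (M * #|K|); clear; lia.
  rewrite subn0 => grow; have := cX (i + g * j - g * j).
  have := leq_mul (leqnn (2 ^ j)) cbig; have : 2 ^ j <= 2 ^ j * (g * q) by rewrite leq_pmulr // muln_gt0 g0.
  by move: grow U_lt; clear; lia.
apply: leq_trans (_ : #|U :\: B (i + g * j)| <= _).
  by apply/subset_leq_card/setDS/Bsub; rewrite mul2n -addnn addnA leq_add2r.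
have := cX (i + g * j); rewrite cardsD (setIidPr _); last by apply: subset_trans (BU _) (subsetDl _ _).
by move: cend Kq; clear; lia.
Qed.

End Expansion.

Lemma bipartite_short_cycles (T : finType) (e : rel T) (chi : T -> bool) p j (U : {set T}) :
  symmetric e -> (forall a b, e a b -> chi a != chi b) -> 0 < p -> 0 < j ->
  U != set0 -> #|U| < 2 ^ j -> (4 * p + 2) * #|U| <= p * e2 e U ->
  exists m c1 c2, [/\ 2 <= m <= (2000 * p + 1000) * j ^ 2,
    ucycle e c1 /\ size c1 = 2 * m, ucycle e c2 /\ size c2 = 2 * m + 2,
    {subset c1 <= U} & {subset c2 <= U}].
Proof.
move=> e_sym bip p0 j0 U0 Uj dU.
have e_irr : irreflexive e by move=> a; apply/negP => /bip; rewrite eqxx.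
pose L := 3 * j; have L0 : 0 < L by rewrite /L muln_gt0.
have logL n : n < 2 ^ j -> trunc_log 2 (n ^ 3) <= L.
  move=> nj; rewrite -(@trunc_expnK 2 L) //; apply: leq_trunc_log.
  by rewrite /L mulnC expnM leq_exp2r // ltnW.
pose good (W : {set T}) := [&& W \subset U, W != set0 & threshold p L #|W| <= p * L * e2 e W].
have gU : good U.
  apply/and3P; split=> //; apply: leq_trans (_ : (4 * p + 2) * L * #|U| <= _).
    rewrite leq_mul2r; apply/orP; right; have := logL _ Uj; clear; lia.
  by rewrite mulnAC [p * L * _]mulnAC leq_mul2r dU orbT.
case: (@arg_minnP _ U good (fun W : {set T} => #|W|) gU) => W /and3P[WU W0 dW] Wmin {gU dU}.
have minW (V : {set T}) : V \proper W -> V != set0 -> p * L * e2 e V < threshold p L #|V|.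
  move=> VW V0; rewrite ltnNge; apply/negP => dV.
  have := Wmin V; rewrite /good V0 dV (subset_trans (proper_sub VW)) // => /(_ isT).
  by rewrite leqNgt proper_card.
have Wj : #|W| < 2 ^ j by apply: leq_ltn_trans Uj; apply: subset_leq_card.
have Wlog := logL _ Wj.
have dW3 := threshold_min_deg e_sym e_irr L0 dW minW.
have cW := threshold_conn e_sym dW minW.
pose M := (4 * p + 2) * L; pose q := 2 * j + 3.
(* [n] is the order from which [giant_ball] applies and also bounds the number of vertices it leaves
   out; [r] is its radius. *)
pose n := 4 * (3 * M + 1) * q; pose r := 2 * M * q + 2 * (2 * M * j).
have [x [D [K [[DW xD Dn] nD KD K0 dK]]]] : exists x (D K : {set T}),
    [/\ [/\ D \subset W, x \in D & #|W :\: D| <= n], forall y, y \in D -> near e x D r.+1 y,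
      K \subset W :\: D, K != set0 & 2 * #|K| <= e2 e K].
  have [big|small] := leqP n #|W|.
    have [K [KW K0 Kq dK]] := small_dense_subset e_sym e_irr W0 dW3 Wj.
    have q0 : 0 < q by rewrite /q addn3.
    have [x xWK co] := giant_ball e_sym L0 W0 Wlog dW minW q0 Wj KW Kq big.
    exists x, (ball e (W :\: K) x r), K; split=> //.
    - split; [|exact: ball_center|].
        exact: subset_trans (ball_sub e r xWK) (subsetDl _ _).
      by apply: leq_trans co _; rewrite /n /M; clear; lia.
    - by move=> y yB; apply: ball_near.
    - apply/subsetP => y yK; rewrite inE (subsetP KW) // andbT.
      by apply: contraL yK => /(subsetP (ball_sub e r xWK)); rewrite inE => /andP[].
  (* When [W] has fewer than [n] vertices, [D] is a single vertex. It takes away at most [#|W| - 1]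
     of at least [2 * #|W|] edges, so the rest is dense enough to serve as [K]. *)
  have [x xW] := set0Pn _ W0.
  have cWx : #|W| = #|W :\ x|.+1 by rewrite (cardsD1 x) xW.
  have dx : deg e W x <= #|W :\ x| by rewrite -(deg_setD1_self e_irr); apply: deg_le_card.
  exists x, [set x], (W :\ x); split=> //.
  - by split; rewrite ?sub1set ?set11 //; move: small; rewrite cWx; clear; lia.
  - move=> y /set1P->; exists [set x]; split; rewrite ?set11 ?cards1 //; exact: conn1.
  - by rewrite -card_gt0; apply: leq_trans dx; apply: ltn_trans (dW3 x xW).
  - have : p * L * (4 * #|W|) <= p * L * e2 e W.
      by apply: leq_trans dW; rewrite /threshold mulnA leq_mul2r -addnA mulnC mulnA leq_addr orbT.
    rewrite leq_pmul2l ?muln_gt0 ?p0 //.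
    by move: (e2_setD1 e_sym e_irr xW) dx; rewrite cWx; clear; lia.
have [D' [c [/andP[c2 cn] uc [DW' cW'] nD' adj]]] :=
  absorb e_sym e_irr (cW x (subsetP DW x xD)) dW3 DW xD Dn nD KD K0 dK.
have cD' : {subset c <= ~: D'} by move=> y /cW'; rewrite !inE => /andP[].
have [m [c1 [c2' [/andP[m2 mn] h1 h2 s1 s2]]]] := cycles_of_attached_cycle e_sym bip nD' c2 uc cD' adj.
have DcU : {subset D' :|: [set z in c] <= U}.
  move=> y; rewrite 2!inE => /orP[/(subsetP DW')/(subsetP WU)//|/cW'].
  by rewrite inE => /andP[_ /(subsetP WU)].
exists m, c1, c2'; split=> //; [|by move=> y /s1/DcU|by move=> y /s2/DcU].
(* The bound is [2 * n + r + 1]. As [q <= 5 * j], it is at most [134 * (M * j) + 41 * j ^ 2], where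
   [M * j = 12 * (p * j ^ 2) + 6 * j ^ 2]. *)
rewrite m2 /=; apply: leq_trans mn _; apply: leq_trans (_ : n + (r.+1 + n) <= _).
  by rewrite leq_add2r.
have qj : q <= 5 * j by rewrite /q; move: j0; clear; lia.
have Mj : M * j = 12 * (p * j ^ 2) + 6 * j ^ 2.
  by rewrite /M /L -mulnn !mulnDl; clear; lia.
have Mq : M * q <= 5 * (M * j) by rewrite mulnCA leq_mul2l qj orbT.
have jj : j <= j ^ 2 by rewrite -{1}(expn1 j) leq_pexp2l.
have nE : n = 12 * (M * q) + 4 * q by rewrite /n mulnDr mulnDl !mulnA.
have rE : r = 2 * (M * q) + 4 * (M * j) by rewrite /r !mulnA.
have -> : (2000 * p + 1000) * j ^ 2 = 2000 * (p * j ^ 2) + 1000 * j ^ 2 by rewrite mulnDl -mulnA.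
rewrite nE rE; move: qj Mj Mq jj j0.
by move: (p * j ^ 2) (j ^ 2) (M * q) (M * j); clear; lia.
Qed.

Definition cut_rel (T : finType) (e : rel T) (chi : T -> bool) := [rel x y | e x y && (chi x != chi y)].

(** Vertices are coloured one by one, each on the side that cuts at least half of its edges to the
    earlier ones. *)
Lemma large_cut (T : finType) (e : rel T) (U : {set T}) : symmetric e -> irreflexive e ->
  exists chi, e2 e U <= 2 * e2 (cut_rel e chi) U.
Proof.
move=> e_sym e_irr.
have cut_sym chi : symmetric (cut_rel e chi) by move=> x y; rewrite /= e_sym eq_sym.
have cut_irr chi : irreflexive (cut_rel e chi) by move=> x; rewrite /= e_irr.
elim: {U}_.+1 {-2}U (ltnSn #|U|) => // n IHn U Un.
have [->|/set0Pn[v vU]] := eqVneq U set0; first by exists xpredT; rewrite e2_set0.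
case: (IHn (U :\ v)); first by move: Un; rewrite (cardsD1 v U) vU.
move=> chi cut; pose chi' b x := if x == v then b else chi x.
have e2chi b : e2 (cut_rel e (chi' b)) (U :\ v) = e2 (cut_rel e chi) (U :\ v).
  rewrite /e2; apply: eq_bigr => x; rewrite !inE /deg => /andP[xv _].
  by apply: eq_bigr => y; rewrite !inE /chi' /= (negPf xv) => /andP[/negPf->].
have degv : deg (cut_rel e (chi' true)) U v + deg (cut_rel e (chi' false)) U v = deg e U v.
  rewrite -!(deg_setD1_self _ U) // /deg -big_split /=; apply: eq_bigr => y.
  rewrite !inE /chi' eqxx => /andP[/negPf-> _].
  by case: (e v y) (chi y) => [] [].
have e2v b := e2_setD1 (cut_sym (chi' b)) (cut_irr (chi' b)) vU.
exists (chi' (deg (cut_rel e (chi' false)) U v <= deg (cut_rel e (chi' true)) U v)).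
rewrite (e2_setD1 e_sym e_irr vU) e2v e2chi -degv.
by case: (leqP (deg (cut_rel e (chi' false)) U v) (deg (cut_rel e (chi' true)) U v)); move: cut; clear; lia.
Qed.

(** * Vertices of large degree *)

Lemma bin_leq_expn n k : 'C(n, k) <= n ^ k.
Proof.
elim: k => [|k IHk]; first by rewrite bin0.
rewrite -(@leq_pmul2l k.+1) // mul_bin_left expnS mulnCA.
apply: leq_mul (leq_subr _ _) (leq_trans IHk _); exact: leq_pmull.
Qed.

Lemma subset_of_card (T : finType) (X : {set T}) k : k <= #|X| -> exists2 S : {set T}, S \subset X & #|S| = k.
Proof.
case/card_geqP => s [us sk sX]; exists [set x in s].
  by apply/subsetP => x; rewrite inE => /sX.
by rewrite cardsE (card_uniqP us).
Qed.

Ltac solve_neq := let E := fresh in apply/eqP => E; subst; match goal with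
  | H : is_true (?x != ?x) |- _ => by rewrite eqxx in H
  | H : is_true (?x \in ?P), H' : is_true (?x \notin ?P) |- _ => by rewrite H in H'
  end.

Ltac solve_distinct := rewrite /= ?inE ?negb_or ?andbT -?andbA;
  repeat (apply/andP; split); solve_neq.

Section HighDegree.
Variables (T : finType) (e : rel T).
Hypotheses (e_sym : symmetric e) (e_irr : irreflexive e).
Implicit Types (A B S U W Q : {set T}) (x y z v : T).

Definition disjoint_even_cycles := exists r c1 c2,
  [/\ 2 <= r, ucycle e c1 /\ size c1 = 2 * r, ucycle e c2 /\ size c2 = 2 * r + 2
    & [disjoint c1 & c2]].

Section Rich.
Variable A : {set T}.

Definition common S := [set v in ~: A | S \subset [set x in A | e v x]].
(** Six common neighbours leave two after any four vertices are excluded, enough for a [C_4]. *)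
Definition rich S := 5 < #|common S|.

Lemma commonP S v x : v \in common S -> x \in S -> [/\ v \notin A, x \in A & e x v].
Proof. by rewrite !inE => /andP[-> /subsetP SN] /SN; rewrite inE e_sym => /andP[]. Qed.

Definition poor_vertices k := [set v | [exists S : {set T},
  [&& S \subset A, #|S| == k, v \in common S & ~~ rich S]]].

(** Pairs of a vertex and a non-rich [k]-set are counted: there are at most [#|A| ^ k] sets, each
    with at most five common neighbours. *)
Lemma card_poor_vertices k : #|poor_vertices k| <= 5 * #|A| ^ k.
Proof.
pose F := [set S : {set T} | (S \subset A) && (#|S| == k)].
have -> : #|poor_vertices k| = \sum_(v in poor_vertices k) 1 by rewrite sum1_card.
apply: leq_trans (_ : \sum_v \sum_(S in F | ~~ rich S) (v \in common S) <= _).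
  rewrite big_mkcond; apply: leq_sum => v _; case: ifP => //; rewrite inE => /existsP[S /and4P[SA Sk vS rS]].
  by rewrite (bigD1 S) /=; [rewrite vS leq_addr | rewrite inE SA Sk].
rewrite exchange_big /=; apply: leq_trans (_ : \sum_(S in F) 5 <= _).
  rewrite big_mkcondr; apply: leq_sum => S _; rewrite /rich; case: (leqP 6) => //= S5.
  rewrite (_ : \sum_v _ = #|common S|) // -sum1_card [RHS]big_mkcond.
  by apply: eq_bigr => v _; case: (v \in _).
by rewrite sum_nat_const mulnC leq_mul2l cards_draws bin_leq_expn.
Qed.

Lemma C4_in_rich S (X : {set T}) (q1 q2 : T) : rich S -> #|X| <= 4 -> q1 \in S -> q2 \in S -> q1 != q2 ->
  exists y1 y2, [/\ ucycle e [:: q1; y1; q2; y2], y1 \in ~: A, y2 \in ~: A, y1 \notin X & y2 \notin X].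
Proof.
move=> rS X4 q1S q2S q12.
have : 1 < #|common S :\: X|.
  by move: rS X4; rewrite /rich -(cardsID X) => rS X4; have := subset_leq_card (subsetIr (common S) X); move: rS X4; clear; lia.
case/card_gt1P => y1 [y2 [/setDP[y1S y1X] /setDP[y2S y2X] y12]].
have [y1A q1A e11] := commonP y1S q1S; have [_ q2A e21] := commonP y1S q2S.
have [y2A _ e12] := commonP y2S q1S; have [_ _ e22] := commonP y2S q2S.
exists y1, y2; split; rewrite ?inE //; apply/andP; split; first by rewrite /= e11 e22 (e_sym y1) e21 (e_sym y2) e12.
by solve_distinct.
Qed.

(** The [C_6] alternates between [S] and three of its common neighbours. At least two vertices of
    [Q] lie outside [S], and they carry a [C_4] avoiding those neighbours. *)
Lemma cycles_of_rich_triple S Q : #|S| = 3 -> #|Q| = 4 -> rich S -> rich Q -> ~~ (S \subset Q) ->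
  disjoint_even_cycles.
Proof.
move=> S3 Q4 rS rQ SQ.
have : 2 < #|S| by rewrite S3.
case/card_gt2P => t1 [t2 [t3 [[t1S t2S t3S] [t12 t23 t31]]]].
have : 2 < #|common S| by apply: leq_trans rS.
case/card_gt2P => x1 [x2 [x3 [[x1S x2S x3S] [x12 x23 x31]]]].
have : 1 < #|Q :\: S|.
  have : #|Q :&: S| < #|S| by apply: proper_card; rewrite properE subsetIr subsetI subxx andbT.
  by have := cardsID S Q; rewrite Q4 S3; clear; lia.
case/card_gt1P => q1 [q2 [/setDP[q1Q q1S] /setDP[q2Q q2S] q12]].
have X3 : #|[set x1; x2; x3]| <= 4 by rewrite !cardsU !cards1; clear; lia.
have [y1 [y2 [C4 y1A y2A]]] := C4_in_rich rQ X3 q1Q q2Q q12.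
rewrite !inE !negb_or in y1A y2A *; move=> /andP[/andP[y11 y12] y13] /andP[/andP[y21 y22] y23].
have nA x t : x \in common S -> t \in S -> [/\ x \notin A, t \in A, e t x & e x t].
  by move=> xS tS; have [xA tA ext] := commonP xS tS; split; rewrite // e_sym.
have [x1A t1A e11 e11'] := nA _ _ x1S t1S; have [x2A t2A e22 e22'] := nA _ _ x2S t2S.
have [x3A t3A e33 e33'] := nA _ _ x3S t3S; have [_ _ e21 _] := nA _ _ x1S t2S.
have [_ _ e32 _] := nA _ _ x2S t3S; have [_ _ e13 e13'] := nA _ _ x3S t1S.
exists 2, [:: q1; y1; q2; y2], [:: t1; x1; t2; x2; t3; x3]; split=> //.
  split=> //; apply/andP; split; first by rewrite /= e11 e22 e33 (e_sym x1) e21 (e_sym x2) e32 e13'.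
  by solve_distinct.
have [q1A q2A] : q1 \in A /\ q2 \in A.
  have /card_gt0P[z zQ] : 0 < #|common Q| by apply: leq_trans rQ.
  by have [_ -> _] := commonP zQ q1Q; have [_ -> _] := commonP zQ q2Q.
rewrite disjoint_has; solve_distinct.
Qed.

(** Distinct neighbours [q] of [w1] and [q'] of [w3] in [Q], with a common neighbour [w] of [Q],
    close the path [w1 v w3] to a [C_6]. The other two vertices of [Q] carry the [C_4]. *)
Lemma cycles_of_triple_path Q w1 v w3 : #|Q| = 4 -> rich Q -> v \notin A ->
  w1 \notin A -> w3 \notin A -> w1 != w3 -> e v w1 -> e v w3 ->
  2 < #|[set x in A | e w1 x] :&: Q| -> 2 < #|[set x in A | e w3 x] :&: Q| -> disjoint_even_cycles.
Proof.
move=> Q4 rQ vA w1A w3A w13 ev1 ev3 d1 d3.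
have /card_gt0P[q] : 0 < #|[set x in A | e w1 x] :&: Q| by apply: leq_trans d1.
rewrite !inE => /andP[/andP[qA e1q] qQ].
have /card_gt0P[q'] : 0 < #|([set x in A | e w3 x] :&: Q) :\ q|.
  by move: d3; rewrite (cardsD1 q); case: (q \in _) => /=; clear; lia.
rewrite !inE => /andP[q'q /andP[/andP[q'A e3q'] q'Q]].
have : 1 < #|Q :\: [set q; q']|.
  have := cardsID [set q; q'] Q; have := subset_leq_card (subsetIr Q [set q; q']).
  by rewrite Q4 cards2; case: (q != q'); clear; lia.
case/card_gt1P => q1 [q2 [/setDP[q1Q q1q] /setDP[q2Q q2q] q12]].
have : 0 < #|common Q :\: [set w1; v; w3]|.
  have : #|[set w1; v; w3]| <= 3 by rewrite !cardsU !cards1; clear; lia.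
  have := cardsID [set w1; v; w3] (common Q); have := subset_leq_card (subsetIr (common Q) [set w1; v; w3]).
  by move: rQ; rewrite /rich; clear; lia.
case/card_gt0P => w /setDP[wQ wX].
have X4 : #|[set w1; v; w3; w]| <= 4 by rewrite !cardsU !cards1; clear; lia.
have [y1 [y2 [C4 y1A y2A]]] := C4_in_rich rQ X4 q1Q q2Q q12.
rewrite !inE !negb_or in y1A y2A wX q1q q2q *.
case/andP: wX => [/andP[ww1 wv] ww3].
move=> /andP[/andP[/andP[y11 y12] y13] y14] /andP[/andP[/andP[y21 y22] y23] y24].
case/andP: q1q => [q1q q1q']; case/andP: q2q => [q2q q2q'].
have [wA _ eqw] := commonP wQ qQ; have [_ _ eq'w] := commonP wQ q'Q.
have [_ q1A _] := commonP wQ q1Q; have [_ q2A _] := commonP wQ q2Q.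
have vw1 : v != w1 by apply: contraTneq ev1 => ->; rewrite e_irr.
have vw3 : v != w3 by apply: contraTneq ev3 => ->; rewrite e_irr.
exists 2, [:: q1; y1; q2; y2], [:: q; w1; v; w3; q'; w]; split=> //.
  split=> //; apply/andP; split; first by rewrite /= (e_sym q) e1q (e_sym w1) ev1 ev3 e3q' eq'w (e_sym w) eqw.
  by solve_distinct.
rewrite disjoint_has; solve_distinct.
Qed.

Lemma sum_deg_le B d k : B \subset ~: A -> (forall v, v \in B -> v \notin poor_vertices k -> deg e A v <= d) ->
  \sum_(v in B) deg e A v <= d * #|B| + 5 * #|A| ^ k.+1.
Proof.
move=> BA Bd; rewrite (big_setID (poor_vertices k)) /= addnC leq_add //.
  apply: leq_trans (_ : \sum_(v in B :\: poor_vertices k) d <= _).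
    by apply: leq_sum => v /setDP[]; exact: Bd.
  by rewrite sum_nat_const mulnC leq_mul2l subset_leq_card ?orbT // subsetDl.
apply: leq_trans (_ : \sum_(v in poor_vertices k) #|A| <= _).
  rewrite big_mkcond [X in _ <= X]big_mkcond; apply: leq_sum => v _; rewrite inE.
  by case: (v \in B) (v \in poor_vertices k) => [] [] //=; apply: deg_le_card.
by rewrite sum_nat_const expnSr mulnA leq_mul2r card_poor_vertices orbT.
Qed.

End Rich.

(* If no four vertices of [A] have six common neighbours, then few vertices have more than three
   neighbours in [A]. Otherwise let [Q] be such a four-set, and [W] the set of the vertices with at
   least three neighbours in [A], all in [Q]. A rich triple not inside [Q] gives a [C_6] avoiding a
   [C_4] through [Q], so few vertices outside [W] have more than two neighbours in [A]; a path of
   length two with ends in [W] is closed through [Q] to a [C_6]. *)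
Lemma high_degree_split K : disjoint_even_cycles \/
  exists U, (forall v, v \in U -> K * deg e setT v <= e2 e setT) /\
    e2 e setT <= e2 e U + 6 * #|U| + 9 * #|~: U| + 11 * K ^ 5.
Proof.
pose m := e2 e setT; rewrite -/m; pose A := [set v | m < K * deg e setT v].
(* Degrees in [A] exceed [m / K] and add up to at most [m]. *)
have AK : #|A| <= K.
  have : #|A| * m.+1 <= K * m.
    rewrite -sum_nat_const; apply: leq_trans (_ : \sum_(v in A) K * deg e setT v <= _).
      by apply: leq_sum => v; rewrite inE.
    rewrite -big_distrr /= leq_mul2l /m /e2 [X in _ <= X](big_setID A) /= setTI leq_addr orbT //.
  case: (posnP #|A|) => [-> //|A0] le; rewrite leqNgt; apply/negP => KA.
  have := leq_mul (ltnW KA) (leqnn m); move: le A0; rewrite mulnS; clear; lia.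
have lowB v : v \in ~: A -> K * deg e setT v <= m by rewrite !inE -leqNgt.
have [K0|K0] := posnP K.
  by right; exists setT; split=> [v _|]; rewrite ?K0 // -!addnA leq_addr.
have AK5 k : 0 < k <= 5 -> #|A| ^ k <= K ^ 5.
  by case/andP=> k0 k5; apply: leq_trans (_ : K ^ k <= _); [rewrite leq_exp2r | rewrite leq_pexp2l].
have mE : m <= K ^ 5 + 2 * \sum_(v in ~: A) deg e A v + e2 e (~: A).
  rewrite /m (e2_setID e_sym (subsetT A)) setTD (deg_exchange e_sym) !leq_add2r.
  apply: leq_trans (_ : \sum_(v in A) #|A| <= _); first by apply: leq_sum => v _; apply: deg_le_card.
  by rewrite sum_nat_const -[_ * _]/(#|A| ^ 2) AK5.
case: (pickP (fun Q : {set T} => [&& Q \subset A, #|Q| == 4 & rich A Q])) => [Q /and3P[QA /eqP Q4 rQ]|no4]; last first.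
  right; exists (~: A); split=> //.
  have : \sum_(v in ~: A) deg e A v <= 3 * #|~: A| + 5 * #|A| ^ 5.
    apply: sum_deg_le => // v vA; rewrite leqNgt; apply: contra => d4.
    rewrite degE in d4; have [S SN S4] := subset_of_card d4.
    have SA : S \subset A by apply: subset_trans SN _; apply/subsetP => x; rewrite inE => /andP[].
    rewrite inE; apply/existsP; exists S; rewrite SA S4 eqxx [v \in _]inE vA SN /=.
    by have := no4 S; rewrite SA S4 eqxx /= => ->.
  by have := AK5 5 isT; move: mE; clear; lia.
case: (pickP (fun S : {set T} => [&& S \subset A, #|S| == 3, rich A S & ~~ (S \subset Q)])) => [S|no3].
  by case/and4P => SA /eqP S3 rS SQ; left; exact: cycles_of_rich_triple S3 Q4 rS rQ SQ.
pose W := [set v in ~: A | (2 < deg e A v) && ([set x in A | e v x] \subset Q)].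
have WA : W \subset ~: A by apply/subsetP => v; rewrite inE => /andP[].
have dWQ v : v \in W -> 2 < #|[set x in A | e v x] :&: Q|.
  by rewrite inE degE => /and3P[_ d3 NQ]; rewrite (setIidPl NQ).
case: (pickP (fun q : T * (T * T) => [&& q.1 \in ~: A, q.2.1 \in W, q.2.2 \in W, q.2.1 != q.2.2,
    e q.1 q.2.1 & e q.1 q.2.2])) => [[v [w1 w3]] /= /and5P[vA w1W w3W w13 /andP[e1 e3]]|nopath].
  have out v' : v' \in W -> v' \notin A by move/(subsetP WA); rewrite inE.
  left; apply: cycles_of_triple_path Q4 rQ _ (out _ w1W) (out _ w3W) w13 e1 e3 (dWQ _ w1W) (dWQ _ w3W).
  by move: vA; rewrite inE.
have degW v : v \in ~: A -> deg e W v <= 1.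
  move=> vA; rewrite leqNgt degE; apply/negP => /card_gt1P[w1 [w3 []]].
  rewrite !inE in vA *; move=> h1 h3 w13.
  have := nopath (v, (w1, w3)); rewrite /= !inE vA w13 /=.
  by move: h1 h3 => /andP[-> ->] /andP[-> ->].
pose U := ~: A :\: W; right; exists U; split.
  by move=> v /setDP[vA _]; apply: lowB.
have sW : \sum_(v in W) deg e A v <= 4 * #|W|.
  rewrite mulnC -sum_nat_const; apply: leq_sum => v; rewrite inE degE => /and3P[_ _ NQ].
  by rewrite -Q4 subset_leq_card.
have sU : \sum_(v in U) deg e A v <= 2 * #|U| + 5 * #|A| ^ 4.
  apply: sum_deg_le => [|v /setDP[vA vW]]; first exact: subsetDl.
  rewrite leqNgt; apply: contra => d3; move: vW; rewrite inE vA d3 /= => /subsetPn[z zN zQ].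
  have : 1 < #|[set x in A | e v x] :\ z| by move: d3; rewrite degE (cardsD1 z) zN.
  case/subset_of_card => S; rewrite subsetD1 => /andP[SN zS] S2.
  have zSN : z |: S \subset [set x in A | e v x] by rewrite subUset sub1set zN SN.
  have zSA : z |: S \subset A by apply: subset_trans zSN _; apply/subsetP => x; rewrite inE => /andP[].
  have zS3 : #|z |: S| = 3 by rewrite cardsU1 zS S2.
  rewrite inE; apply/existsP; exists (z |: S); rewrite zSA zS3 eqxx [v \in _]inE vA zSN /=.
  have := no3 (z |: S); rewrite zSA zS3 eqxx /= => /negbT; rewrite negb_and negbK => /orP[//|].
  by rewrite subUset sub1set (negPf zQ).
have cU : #|~: A| = #|W| + #|U| by rewrite -(cardsID W (~: A)) (setIidPr WA).
have WU : #|W| <= #|~: U| by apply: subset_leq_card; apply/subsetP => v vW; rewrite in_setC /U in_setD vW.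
have sB : \sum_(v in ~: A) deg e A v = \sum_(v in W) deg e A v + \sum_(v in U) deg e A v.
  by rewrite (big_setID W) /= (setIidPr WA).
have sBW : e2 e W + \sum_(v in U) deg e W v <= #|~: A|.
  have <- : \sum_(v in ~: A) deg e W v = e2 e W + \sum_(v in U) deg e W v.
    by rewrite (big_setID W) /= (setIidPr WA).
  by rewrite -sum1_card; apply: leq_sum.
have sUW : \sum_(v in U) deg e W v <= #|U|.
  by rewrite -sum1_card; apply: leq_sum => v /setDP[vA _]; apply: degW.
(* A vertex of [W] costs [2 * 4 + 1 = 9] and a vertex of [U] costs [2 * 2 + 2 = 6]; the edges inside
   [A] and the poor vertices cost [K ^ 5] and [10 * K ^ 5]. *)
move: (AK5 4 isT) mE sB sBW sUW sU sW WU cU; rewrite (e2_setID e_sym WA) -/U (deg_exchange e_sym W U).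
clear; lia.
Qed.

End HighDegree.

(** * Two disjoint cycles *)

Lemma short_cycles (T : finType) (e : rel T) p j (U : {set T}) :
  symmetric e -> irreflexive e -> 0 < p -> 0 < j ->
  U != set0 -> #|U| < 2 ^ j -> (8 * p + 4) * #|U| <= p * e2 e U ->
  exists m c1 c2, [/\ 2 <= m <= (2000 * p + 1000) * j ^ 2,
    ucycle e c1 /\ size c1 = 2 * m, ucycle e c2 /\ size c2 = 2 * m + 2,
    {subset c1 <= U} & {subset c2 <= U}].
Proof.
move=> e_sym e_irr p0 j0 U0 Uj dU.
have [chi cut] := large_cut U e_sym e_irr.
have cut_sym : symmetric (cut_rel e chi) by move=> x y; rewrite /= e_sym eq_sym.
have bip a b : cut_rel e chi a b -> chi a != chi b by case/andP.
have uc c : ucycle (cut_rel e chi) c -> ucycle e c.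
  case/andP=> cc uc; rewrite /ucycle uc andbT; case: c cc {uc} => //= x c.
  by apply: sub_path => a b /andP[].
have dcut : (4 * p + 2) * #|U| <= p * e2 (cut_rel e chi) U.
  by have := leq_mul (leqnn p) cut; move: dU; clear; lia.
have [m [c1 [c2 [m2 [/uc uc1 s1] [/uc uc2 s2] c1U c2U]]]] :=
  bipartite_short_cycles cut_sym bip p0 j0 U0 Uj dcut.
by exists m, c1, c2.
Qed.

(* Pigeonhole on [m]: remove a cycle of length [2m] for each value of [m] met so far. *)
Lemma disjoint_cycles_of_robust (T : finType) (e : rel T) s (U : {set T}) :
  (forall X : {set T}, #|X| <= 2 * s ^ 2 -> exists m c1 c2, [/\ 2 <= m <= s,
    ucycle e c1 /\ size c1 = 2 * m, ucycle e c2 /\ size c2 = 2 * m + 2,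
    {subset c1 <= U :\: X} & {subset c2 <= U :\: X}]) ->
  disjoint_even_cycles e.
Proof.
move=> robust.
have step k : k <= s.+1 -> disjoint_even_cycles e \/ exists ms (X : {set T}),
    [/\ uniq ms, size ms = k, {subset ms <= iota 2 s.-1}, #|X| <= 2 * s * k &
      forall m, m \in ms -> exists c, [/\ ucycle e c, size c = 2 * m & {subset c <= X}]].
  elim: k => [|k IHk] ks; first by right; exists [::], set0; rewrite cards0.
  case: (IHk (ltnW ks)) => [|[ms [X [ums sms ms2 Xk msX]]]]; first by left.
  have [|m [c1 [c2 [/andP[m2 mk] [uc1 s1] [uc2 s2] c1X c2X]]]] := robust X.
    by apply: leq_trans Xk _; rewrite -mulnn mulnA leq_mul2l -ltnS ks orbT.
  case: (boolP (m \in ms)) => [mms|nms].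
    have [c [uc sc cX]] := msX m mms; left; exists m, c, c2; split=> //.
    rewrite disjoint_has; apply/hasPn => x /cX xX; apply/negP => /c2X.
    by rewrite inE xX.
  right; exists (m :: ms), (X :|: [set x in c1]); split=> /=.
  - by rewrite nms.
  - by rewrite sms.
  - move=> a; rewrite inE => /orP[/eqP->|/ms2//]; rewrite mem_iota m2 /=; move: mk m2; clear; lia.
  - apply: leq_trans (leq_of_leqif (leq_card_setU _ _)) _; rewrite mulnS addnC leq_add //.
    by rewrite cardsE (leq_trans (card_size _)) // s1 leq_mul2l mk.
  - move=> a; rewrite inE => /orP[/eqP->|/msX[c [uc sc cX]]].
      by exists c1; split=> // x xc; rewrite !inE xc orbT.
    by exists c; split=> // x /cX xX; rewrite inE xX.
(* Only [s - 1] values lie between 2 and [s], so [s] distinct ones are impossible. Applying [robust]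
   to [set0] gives [2 <= s], which excludes the truncated predecessor of 0. *)
case: (step s (leqnSn s)) => [//|[ms [X [ums sms ms2 _ _]]]].
have := uniq_leq_size ums ms2; rewrite sms size_iota.
have [m [c1 [c2 [/andP[m2 mk] _ _ _ _]]]] := robust set0 (leq_trans (eq_leq (cards0 _)) (leq0n _)).
by move: m2 mk; clear; lia.
Qed.

(** With [D = d + 1], the bound [j <= 2 ^ (j %/ D) * D] raised to the power [D] gives
    [j ^ D <= 2 ^ j * D ^ D]; the spare factor [j] absorbs the constants. *)
Lemma expn_dominates C d : exists j0, forall j, j0 <= j -> C * j ^ d <= 2 ^ j.
Proof.
pose D := d.+1; exists (C * D ^ D) => j jC.
have jD : j ^ D <= 2 ^ j * D ^ D.
  have jt : j <= 2 ^ (j %/ D) * D.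
    rewrite {1}(divn_eq j D); apply: leq_trans (_ : (j %/ D).+1 * D <= _).
      by rewrite mulSn addnC leq_add2r ltnW // ltn_pmod.
    by rewrite leq_mul2r ltn_expl ?orbT.
  apply: leq_trans (_ : (2 ^ (j %/ D) * D) ^ D <= _); first by rewrite leq_exp2r.
  by rewrite expnMn leq_mul2r -expnM leq_exp2l // leq_trunc_div orbT.
rewrite -(@leq_pmul2r (D ^ D)) ?expn_gt0 //; apply: leq_trans jD.
by rewrite mulnAC [j ^ D]expnS leq_mul2r jC orbT.
Qed.

(** Average degree 14 pays 6 for each of the [u] vertices kept and 9 for each of the [w] others, so
    8 is left on the former. The excess [1 / p] covers the loss of [m / (30 * p)] and the term in
    [k], and a quarter of it survives. *)
Lemma density_arith p n m x u w k : 0 < p -> (14 * p + 1) * n <= p * m ->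
  30 * (p * m) <= 30 * (p * x) + m + 180 * (p * u) + 270 * (p * w) + 330 * (p * k) ->
  44 * p * k <= n -> u + w = n -> (32 * p + 1) * u + w <= 4 * (p * x).
Proof.
move=> p0 dm mx kn uw; pose y := 30 * x + 180 * u + 270 * w + 330 * k.
have {}mx : 30 * (p * (p * m)) <= p * (p * y) + p * m.
  by have := leq_mul (leqnn p) mx; rewrite /y; clear; lia.
have : p * ((420 * p + 15) * n) <= p * (p * y).
  case: p p0 dm mx {kn} => // q _; move: (q.+1 * m) => z dz mz.
  by have := leq_mul (leqnn (30 * q + 29)) dz; move: mz; clear; lia.
rewrite leq_pmul2l // /y; move: kn uw; clear; lia.
Qed.

Lemma disjoint_even_cycles_of_dense p : 0 < p -> exists n0, forall (T : finType) (e : rel T),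
  symmetric e -> irreflexive e -> n0 <= #|T| -> (14 * p + 1) * #|T| <= p * e2 e setT ->
  disjoint_even_cycles e.
Proof.
(* The excess left by [density_arith] is [1 / (4 * p) = 4 / (16 * p)], so [short_cycles] is applied
   with [16 * p]. *)
move=> p0; pose c := 2000 * (16 * p) + 1000; pose k := 120 * p * c ^ 2.
(* Below, [K ^ 5 = k ^ 5 * j ^ 20]. The factor is [88 = 2 * 44] because [2 ^ j] can be twice the
   order. *)
have [j0 Hj0] := expn_dominates (88 * p * k ^ 5) 20.
exists (2 ^ j0) => T e e_sym e_irr nT dT.
have n0 : 0 < #|T| by apply: leq_trans nT; rewrite expn_gt0.
pose j := (trunc_log 2 #|T|).+1.
have Tj : #|T| < 2 ^ j by apply: trunc_log_ltn.
have jT : 2 ^ j <= 2 * #|T| by rewrite expnS leq_mul2l trunc_logP.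
have jj0 : j0 <= j by apply: leqW; apply: trunc_log_max.
(* Deleting [2 * s ^ 2] vertices of degree at most [e2 e setT / K] costs at most the fraction
   [4 * s ^ 2 / K = 1 / (30 * p)] of [e2 e setT]. *)
pose s := c * j ^ 2; pose K := 120 * p * s ^ 2.
have KE : K ^ 5 = k ^ 5 * j ^ 20.
  have -> : K = k * j ^ 4 by rewrite /K /s expnMn -expnM mulnA.
  by rewrite expnMn -expnM.
have err : 44 * p * K ^ 5 <= #|T|.
  have := leq_trans (Hj0 j jj0) jT; rewrite -mulnA -KE; move: (K ^ 5); clear; lia.
case: (high_degree_split e_sym e_irr K) => // [[U [lowU mU]]].
apply: (@disjoint_cycles_of_robust _ _ s U) => X Xs.
have XU : U :&: X \subset U := subsetIl U X.
have split : K * e2 e U <= K * e2 e (U :\: X) + 2 * (#|X| * e2 e setT).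
  have <- : U :\: (U :&: X) = U :\: X by rewrite setDIr setDv set0U.
  have : K * \sum_(x in U :&: X) deg e U x <= #|X| * e2 e setT.
    rewrite big_distrr /=; apply: leq_trans (_ : \sum_(x in U :&: X) e2 e setT <= _).
      apply: leq_sum => x /setIP[xU _]; apply: leq_trans (lowU x xU).
      by rewrite leq_mul2l leq_deg ?subsetT ?orbT.
    by rewrite sum_nat_const leq_mul2r subset_leq_card ?subsetIr ?orbT.
  have : e2 e U <= e2 e (U :\: (U :&: X)) + 2 * \sum_(x in U :&: X) deg e U x.
    rewrite (e2_setID e_sym XU).
    have -> : \sum_(x in U :&: X) deg e U x = e2 e (U :&: X) + \sum_(x in U :&: X) deg e (U :\: (U :&: X)) x.
      rewrite /e2 -big_split /=; apply: eq_bigr => x _.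
      by rewrite (deg_setID e U (U :&: X)) (setIidPr XU).
    by clear; lia.
  move/(leq_mul (leqnn K)); rewrite mulnDr [K * (2 * _)]mulnCA; move: (K * \sum_(x in _) _).
  by clear; lia.
have s0 : 0 < s by rewrite /s muln_gt0 expn_gt0 /c addn_gt0 orbT.
have s4 : 0 < 4 * s ^ 2 by rewrite muln_gt0 expn_gt0 s0.
have {}split : 30 * (p * e2 e U) <= 30 * (p * e2 e (U :\: X)) + e2 e setT.
  rewrite -(leq_pmul2l s4).
  have E a : 4 * s ^ 2 * (30 * (p * a)) = K * a by rewrite /K; move: (s ^ 2) => b; clear; lia.
  rewrite mulnDr !E; apply: leq_trans split _; rewrite leq_add2l.
  by have := leq_mul Xs (leqnn (e2 e setT)); clear; lia.
have cU : #|U| + #|~: U| = #|T| := cardsC U.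
have eX : (32 * p + 1) * #|U| + #|~: U| <= 4 * (p * e2 e (U :\: X)).
  apply: density_arith p0 dT _ err cU; have := leq_mul (leqnn p) mU; move: split.
  by move: (K ^ 5); clear; lia.
have UX0 : U :\: X != set0.
  by apply/eqP => UX; move: eX; rewrite UX e2_set0 !muln0; move: n0; rewrite -cU; clear; lia.
have UXj : #|U :\: X| < 2 ^ j by apply: leq_ltn_trans Tj; exact: max_card.
have dUX : (8 * (16 * p) + 4) * #|U :\: X| <= 16 * p * e2 e (U :\: X).
  apply: leq_trans (_ : (8 * (16 * p) + 4) * #|U| <= _).
    by rewrite leq_mul2l subset_leq_card ?orbT // subsetDl.
  by move: eX; clear; lia.
by apply: short_cycles dUX; rewrite ?muln_gt0.
Qed.

Import Order.TTheory GRing.Theory Num.Theory.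
Local Open Scope ring_scope.

Theorem theorem5p1 (R : realType) (eps : R) (eps_gt0 : 0 < eps) :
  exists n_eps : nat, forall G : sgraph,
    (n_eps <= #|G|)%N ->
    14 + eps <= avg_degree R G ->
    exists (r : nat) (c1 c2 : seq G),
      [/\ (2 <= r)%N,
          graph_cycle c1 /\ size c1 = (2 * r)%N,
          graph_cycle c2 /\ size c2 = (2 * r + 2)%N
        & [disjoint c1 & c2]].
Proof.
(* The real excess [eps] is replaced by the smaller [1 / p], which makes the density condition one
   on natural numbers. *)
pose p := Num.bound eps^-1.
have peps : 1 < p%:R * eps by rewrite -ltr_pdivrMr // div1r archi_boundP // invr_ge0 ltW.
have p0 : (0 < p)%N by rewrite lt0n; apply: contraTneq peps => ->; rewrite mul0r ltr10.
have [n0 dense] := disjoint_even_cycles_of_dense p0; exists n0 => G Gn avg.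
have [//|r [c1 [c2 [r2 [uc1 s1] [uc2 s2] dis]]]] := dense G (@adj G) (@adj_sym G) (@adj_irrefl G) Gn.
  rewrite (_ : e2 _ _ = \sum_(x : G) degree x)%N; last first.
    rewrite /e2 [LHS](eq_bigl xpredT) => [|x]; last by rewrite inE.
    by apply: eq_bigr => x _; rewrite degE; apply: eq_card => y; rewrite !inE.
  case: (posnP #|G|) => [->|G0]; first by rewrite muln0.
  rewrite -(@ler_nat R) !natrM natrD natrM.
  move: avg; rewrite /avg_degree ler_pdivlMr ?ltr0n // => avg.
  apply: le_trans (_ : p%:R * ((14 + eps) * #|G|%:R) <= _); last by rewrite ler_wpM2l ?ler0n.
  rewrite mulrA ler_wpM2r ?ler0n // mulrDr [p%:R * 14]mulrC lerD2l; exact: ltW.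
exists r, c1, c2; split=> //; (split=> //; split=> //); rewrite ?s1 ?s2.
- by rewrite (@leq_trans (2 * 2)) // leq_mul2l.
- by rewrite (@leq_trans (2 * 2 + 2)) // leq_add2r leq_mul2l.
Qed.
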